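(* For every integer $k$, \textsc{Subset Rainbow $k$-Coloring} parameterized by $|S|$ is fixed-parameter tractable: it can be solved in time $(k^2|S|)^{k|S|}2^k n^{O(1)}$, where $n$ is the number of vertices; in particular in time $|S|^{O(|S|)}n^{O(1)}$ for every fixed $k$.
   Context: A path is rainbow if its edges have pairwise different colors. \textsc{Subset Rainbow $k$-Coloring}: given a connected graph $G$ and a set $S\subseteq\binom{V(G)}{2}$ of vertex pairs (requests), decide whether there is a coloring of $E(G)$ with $k$ colors such that every pair in $S$ is connected by a rainbow path. *)

(* Defs.v *)
From mathcomp Require Import all_boot.

Set Implicit Arguments.
Unset Strict Implicit.
Unset Printing Implicit Defensive.

(* ** Random access machines

   Structured programs over integer registers and integer arrays, under the
   unit-cost measure.  As in the usual definition of the additive RAM, the only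
   arithmetic operations are addition and truncated subtraction: each unit of
   time lengthens the binary representation of a number by at most one bit, so
   that unit-cost time is polynomially related to Turing machine time (with a
   unit-cost multiplication it would not be). *)

Inductive expr : Type :=
| Const of nat
| Reg of nat
| Get of nat & expr
| Add of expr & expr
| Sub of expr & expr.

Inductive cmd : Type :=
| Skip
| Assign of nat & expr
| Put of nat & expr & expr
| Seq of cmd & cmd
| If of expr & cmd & cmd
| While of expr & cmd.

Record state : Type := State {
  reg : nat -> nat;
  arr : nat -> nat -> nat
}.

Definition set_reg (s : state) (x v : nat) : state :=
  State (fun y => if y == x then v else reg s y) (arr s).

Definition set_arr (s : state) (a i v : nat) : state :=
  State (reg s)
    (fun b j => if (b == a) && (j == i) then v else arr s b j).

Fixpoint eval (s : state) (e : expr) : nat :=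
  match e with
  | Const n => n
  | Reg x => reg s x
  | Get a e1 => arr s a (eval s e1)
  | Add e1 e2 => eval s e1 + eval s e2
  | Sub e1 e2 => eval s e1 - eval s e2
  end.

Fixpoint cost (e : expr) : nat :=
  match e with
  | Const _ | Reg _ => 1
  | Get _ e1 => (cost e1).+1
  | Add e1 e2 | Sub e1 e2 => (cost e1 + cost e2).+1
  end.

(* [exec c s t s']: started in state [s], the program [c] halts after exactly
   [t] units of time in state [s'].  A test succeeds when its value is not 0. *)
Inductive exec : cmd -> state -> nat -> state -> Prop :=
| ExecSkip s :
    exec Skip s 1 s
| ExecAssign s x e :
    exec (Assign x e) s (cost e).+1 (set_reg s x (eval s e))
| ExecPut s a e1 e2 :
    exec (Put a e1 e2) s (cost e1 + cost e2).+1
         (set_arr s a (eval s e1) (eval s e2))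
| ExecSeq c1 c2 s s1 s2 t1 t2 :
    exec c1 s t1 s1 -> exec c2 s1 t2 s2 -> exec (Seq c1 c2) s (t1 + t2) s2
| ExecIfTrue e c1 c2 s s' t :
    eval s e != 0 -> exec c1 s t s' ->
    exec (If e c1 c2) s ((cost e).+1 + t) s'
| ExecIfFalse e c1 c2 s s' t :
    eval s e == 0 -> exec c2 s t s' ->
    exec (If e c1 c2) s ((cost e).+1 + t) s'
| ExecWhileEnd e c s :
    eval s e == 0 -> exec (While e c) s (cost e).+1 s
| ExecWhileStep e c s s1 s2 t1 t2 :
    eval s e != 0 -> exec c s t1 s1 -> exec (While e c) s1 t2 s2 ->
    exec (While e c) s ((cost e).+1 + t1 + t2) s2.

Lemma exec_deterministic c s t1 s1 t2 s2 :
  exec c s t1 s1 -> exec c s t2 s2 -> t1 = t2 /\ s1 = s2.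
Proof.
move=> H1; elim: H1 t2 s2 => {c s t1 s1} *;
  match goal with H : exec _ _ _ _ |- _ = _ /\ _ = _ => inversion H; subst end;
  repeat match goal with
  | H1 : is_true (?b != 0), H2 : is_true (?b == 0) |- _ =>
      by rewrite H2 in H1
  | IH : forall t s, exec ?c ?s0 t s -> _, H : exec ?c ?s0 _ _ |- _ =>
      case: (IH _ _ H) => ? ?; clear IH; subst
  end; by [].
Qed.

(* The input word is stored in array 0 and its length in register 0; every
   other register and array cell holds 0.  The output is read in register 0. *)
Definition init (w : seq nat) : state :=
  State (fun x => if x == 0 then size w else 0)
        (fun a i => if a == 0 then nth 0 w i else 0).

Definition output (s : state) : nat := reg s 0.

Definition computable (f : nat -> nat) : Prop :=
  exists p : cmd, forall m : nat,
    exists t s, exec p (init [:: m]) t s /\ output s = f m.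

(* ** Parameterized problems *)

Record param_problem : Type := ParamProblem {
  instance : Type;
  encode : instance -> seq nat;
  parameter : instance -> nat;
  yes_instance : instance -> Prop
}.

Definition solvable_in_time (P : param_problem) (T : instance P -> nat) : Prop :=
  exists p : cmd, forall I : instance P,
    exists t s, [/\ exec p (init (encode I)) t s,
                    (output s <> 0 <-> yes_instance I)
                  & t <= T I].

Definition fixed_parameter_tractable (P : param_problem) : Prop :=
  exists (f : nat -> nat) (c : nat), computable f /\
    @solvable_in_time P (fun I => f (parameter I) * size (encode I) ^ c).

(* ** Subset Rainbow k-Coloring *)

Record request_graph : Type := RequestGraph {
  nvertices : nat;
  adj : rel 'I_nvertices;
  requests : {set {set 'I_nvertices}};
  nvertices_gt0 : 0 < nvertices;
  adj_sym : symmetric adj;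
  adj_irrefl : irreflexive adj;
  adj_connected : forall u v, connect adj u v;
  requests_card2 : forall R, R \in requests -> #|R| = 2
}.

(* The color of the edge uv is [col [set u; v]]; the values of [col] on sets
   that are not edges are irrelevant. *)
Definition edge_coloring (k n : nat) (e : rel 'I_n) (col : {set 'I_n} -> nat) :
    Prop :=
  forall u v, e u v -> col [set u; v] < k.

Definition rainbow_path (n : nat) (e : rel 'I_n) (col : {set 'I_n} -> nat)
    (u v : 'I_n) (p : seq 'I_n) : Prop :=
  [/\ path e u p, last u p = v, uniq (u :: p)
    & uniq (pairmap (fun x y => col [set x; y]) u p)].

Definition subset_rainbow_colorable (k : nat) (G : request_graph) : Prop :=
  exists col : {set 'I_(nvertices G)} -> nat,
    edge_coloring k (@adj G) col /\
    forall u v, [set u; v] \in requests G ->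
      exists p, rainbow_path (@adj G) col u v p.

(* The number of vertices, followed by the adjacency matrix and by the 0/1
   matrix of the requested pairs, both in row-major order. *)
Definition encode_request_graph (G : request_graph) : seq nat :=
  nvertices G ::
    [seq nat_of_bool (adj u v)
       | u <- enum 'I_(nvertices G), v <- enum 'I_(nvertices G)] ++
    [seq nat_of_bool ([set u; v] \in requests G)
       | u <- enum 'I_(nvertices G), v <- enum 'I_(nvertices G)].

Definition subset_rainbow_coloring (k : nat) : param_problem :=
  {| instance := request_graph;
     encode := encode_request_graph;
     parameter := fun G => #|requests G|;
     yes_instance := subset_rainbow_colorable k |}.

(* Main.v *)
(* A color-coding algorithm with an explicit family of colorings.

   Let [s] be the number of requests, [q = k * s] and [w = n ^ 2].  A solution
   matters only through the at most [q] edges of one rainbow path per request,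
   so it suffices to try a family of colorings inducing every coloring of every
   set [F] of at most [q] edges.  Number the edges by integers below [w] and hash
   [x] to [((a * x) mod (R * w)) / w], where [R] is about [q ^ 2 / 8].  For [x <> y],
   at most [5 * w] of the [R * w] multipliers [a] make [x] and [y] collide, so some
   [a] creates at most 40 ordered collisions inside [F].  The edges involved are
   enumerated explicitly together with their colors; on the others the hash is
   injective, and it remains to enumerate the subsets of size at most [q] of [R]
   cells with their colors.  With the cells arranged in [q + 1] rows of width
   [b = q / 8 + 1], this takes [2 * q] bits, [q] columns and [q] colors, that is
   [(4 * b) ^ q * k ^ q] possibilities, which is [O((k * q) ^ q)].  Each coloring is
   tested by dynamic programming over the sets of colors, in time [2 ^ k]
   times a polynomial. *)

(* With [q = k * s] the target [(k ^ 2 * s) ^ (k * s)] is exactly [q ^ q * k ^ q], and the constants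
   may not depend on [k]. The enumeration therefore cannot afford an extra factor [c ^ q], and this
   fixes the numbers. With the collision bound used here, a hash injective on all of [F] would need
   [R] above [5 * q ^ 2], hence rows of about [5 * q] cells and [(20 * q) ^ q] choices. Shrinking
   [R] to about [q ^ 2 / 8] gives [4 * b <= q] for [q >= 8], at the price of boundedly many
   collisions. Guessing the edges involved and their colors costs a factor [(n ^ 2 * k) ^ 40], which
   is polynomial in [n] because [k >= n ^ 2] is answered directly. The rows serve the same economy:
   naming a cell outright costs a factor [R], whereas cells visited in increasing order are named by
   their column alone, the bits telling when to change rows. *)
From mathcomp Require Import all_boot.
From mathcomp Require Import zify.
Require Import Defs.

Set Implicit Arguments.
Unset Strict Implicit.
Unset Printing Implicit Defensive.

(** * Programs with bounded loops *)

(* [For i x b] runs [b] with register [i] ranging over [0, ..., reg x - 1]. *)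
Inductive prog : Type :=
| PSkip
| PAssign of nat & expr
| PPut of nat & expr & expr
| PSeq of prog & prog
| PIf of expr & prog & prog
| PFor of nat & nat & prog.

Fixpoint compile (c : prog) : cmd :=
  match c with
  | PSkip => Skip
  | PAssign x e => Assign x e
  | PPut a e1 e2 => Put a e1 e2
  | PSeq c1 c2 => Seq (compile c1) (compile c2)
  | PIf e c1 c2 => If e (compile c1) (compile c2)
  | PFor i x b =>
      Seq (Assign i (Const 0))
        (While (Sub (Reg x) (Reg i))
           (Seq (compile b) (Assign i (Add (Reg i) (Const 1)))))
  end.

Definition for_step (i : nat) (f : state -> state) (s : state) : state :=
  set_reg (f s) i (reg (f s) i + 1).

Fixpoint sem (c : prog) (s : state) : state :=
  match c with
  | PSkip => s
  | PAssign x e => set_reg s x (eval s e)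
  | PPut a e1 e2 => set_arr s a (eval s e1) (eval s e2)
  | PSeq c1 c2 => sem c2 (sem c1 s)
  | PIf e c1 c2 => if eval s e != 0 then sem c1 s else sem c2 s
  | PFor i x b => iter (reg s x) (for_step i (sem b)) (set_reg s i 0)
  end.

Fixpoint wregs (c : prog) : seq nat :=
  match c with
  | PSkip | PPut _ _ _ => [::]
  | PAssign x _ => [:: x]
  | PSeq c1 c2 | PIf _ c1 c2 => wregs c1 ++ wregs c2
  | PFor i _ b => i :: wregs b
  end.

Fixpoint warrs (c : prog) : seq nat :=
  match c with
  | PSkip | PAssign _ _ => [::]
  | PPut a _ _ => [:: a]
  | PSeq c1 c2 | PIf _ c1 c2 => warrs c1 ++ warrs c2
  | PFor _ _ b => warrs b
  end.

Fixpoint bounds (c : prog) : seq nat :=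
  match c with
  | PSkip | PAssign _ _ | PPut _ _ _ => [::]
  | PSeq c1 c2 | PIf _ c1 c2 => bounds c1 ++ bounds c2
  | PFor _ x b => x :: bounds b
  end.

Fixpoint counters_ok (c : prog) : bool :=
  match c with
  | PSkip | PAssign _ _ | PPut _ _ _ => true
  | PSeq c1 c2 | PIf _ c1 c2 => counters_ok c1 && counters_ok c2
  | PFor i _ b => (i \notin wregs b) && counters_ok b
  end.

(** No register that bounds a loop is ever written, so every number of iterations can be read off in
    the initial state; this is what makes a static time bound possible. *)
Definition stable (c : prog) : bool :=
  counters_ok c && all (fun x => x \notin wregs c) (bounds c).

(** Tests are not evaluated, so both branches of a conditional are charged. In a loop, 4 pays for a
    test, 4 for the increment and 2 for the initialization: 8 per iteration, and 6 for the
    initialization and the last test. *)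
Fixpoint tbound (c : prog) (s : state) : nat :=
  match c with
  | PSkip => 1
  | PAssign _ e => (cost e).+1
  | PPut _ e1 e2 => (cost e1 + cost e2).+1
  | PSeq c1 c2 => tbound c1 s + tbound c2 s
  | PIf e c1 c2 => (cost e).+1 + (tbound c1 s + tbound c2 s)
  | PFor _ x b => 6 + reg s x * (tbound b s + 8)
  end.

Fixpoint psize (c : prog) : nat :=
  match c with
  | PSkip => 1
  | PAssign _ e => (cost e).+1
  | PPut _ e1 e2 => (cost e1 + cost e2).+1
  | PSeq c1 c2 => psize c1 + psize c2
  | PIf e c1 c2 => (cost e).+1 + (psize c1 + psize c2)
  | PFor _ _ b => psize b + 8
  end.

Lemma sem_reg c s x : x \notin wregs c -> reg (sem c s) x = reg s x.
Proof.
elim: c s => [|y e|a e1 e2|c1 IH1 c2 IH2|e c1 IH1 c2 IH2|i y b IH] s //=.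
- by rewrite inE => /negbTE->.
- by rewrite mem_cat negb_or => /andP[H1 H2]; rewrite IH2 // IH1.
- rewrite mem_cat negb_or => /andP[H1 H2].
  by case: ifP => _; [apply: IH1|apply: IH2].
- rewrite inE negb_or => /andP[/negbTE xi xb].
  elim: (reg s y) => [|m IHm] /=; first by rewrite xi.
  by rewrite xi IH.
Qed.

Lemma sem_arr c s a j : a \notin warrs c -> arr (sem c s) a j = arr s a j.
Proof.
elim: c s => [|y e|a' e1 e2|c1 IH1 c2 IH2|e c1 IH1 c2 IH2|i y b IH] s //=.
- by rewrite inE => /negbTE->.
- by rewrite mem_cat negb_or => /andP[H1 H2]; rewrite IH2 // IH1.
- rewrite mem_cat negb_or => /andP[H1 H2].
  by case: ifP => _; [apply: IH1|apply: IH2].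
- move=> xb.
  elim: (reg s y) => [|m IHm] //=.
  by rewrite IH.
Qed.

(** Invariant rule for loops. The step also receives the frame facts (whatever the body does not
    write is as before the loop), so invariants need only speak of what changes. *)
Lemma sem_for i x b s (I : nat -> state -> Prop) :
  i \notin wregs b ->
  I 0 (set_reg s i 0) ->
  (forall s', reg s' i < reg s x ->
     (forall y, y \notin i :: wregs b -> reg s' y = reg s y) ->
     (forall a j, a \notin warrs b -> arr s' a j = arr s a j) ->
     I (reg s' i) s' ->
     I (reg s' i).+1 (set_reg (sem b s') i (reg s' i).+1)) ->
  I (reg s x) (sem (PFor i x b) s).
Proof.
move=> ib I0 IS /=.
suff H m : m <= reg s x -> let s' := iter m (for_step i (sem b)) (set_reg s i 0) in
  [/\ I m s', reg s' i = m,
      (forall y, y \notin i :: wregs b -> reg s' y = reg s y) &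
     (forall a j, a \notin warrs b -> arr s' a j = arr s a j)].
  by case: (H _ (leqnn _)).
elim: m => [|m IHm] lem /=.
  split=> //=; first by rewrite eqxx.
  by move=> y; rewrite inE negb_or => /andP[/negbTE->].
case: (IHm (ltnW lem)) => {IHm}; set s' := iter m _ _ => Is' ri rs as'.
have := IS s'; rewrite ri => /(_ lem rs as' Is') Im.
rewrite /for_step sem_reg // ri addn1; split=> //=.
- by rewrite eqxx.
- move=> y yb; move: (yb); rewrite inE negb_or => /andP[/negbTE-> yb'].
  by rewrite sem_reg // rs.
- by move=> a j ab; rewrite sem_arr // as'.
Qed.

Lemma tbound_eq c s s' :
  {in bounds c, forall x, reg s x = reg s' x} -> tbound c s = tbound c s'.
Proof.
elim: c => [|y e|a e1 e2|c1 IH1 c2 IH2|e c1 IH1 c2 IH2|i y b IH] //= H.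
- by rewrite IH1 ?IH2 // => x xc; apply: H; rewrite mem_cat xc ?orbT.
- by rewrite IH1 ?IH2 // => x xc; apply: H; rewrite mem_cat xc ?orbT.
- by rewrite H ?mem_head // IH // => x xb; apply: H; rewrite inE xb orbT.
Qed.

Lemma exec_prog c s :
  stable c -> exists2 t, exec (compile c) s t (sem c s) & t <= tbound c s.
Proof.
rewrite /stable => /andP[].
elim: c s => [|y e|a e1 e2|c1 IH1 c2 IH2|e c1 IH1 c2 IH2|i x b IH] s /=.
- by exists 1 => //; constructor.
- by exists (cost e).+1 => //; constructor.
- by exists (cost e1 + cost e2).+1 => //; constructor.
- move=> /andP[ok1 ok2] /allP st.
  have [||t1 e1 l1] := IH1 s => //.
    apply/allP => x xc; have := st x; rewrite !mem_cat xc => /(_ isT).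
    by rewrite negb_or => /andP[].
  have [||t2 e2 l2] := IH2 (sem c1 s) => //.
    apply/allP => x xc; have := st x; rewrite !mem_cat xc orbT => /(_ isT).
    by rewrite negb_or => /andP[].
  exists (t1 + t2); first exact: ExecSeq e1 e2.
  rewrite leq_add // (leq_trans l2) // (@tbound_eq c2 _ s) // => x xc.
  rewrite sem_reg //; have := st x; rewrite !mem_cat xc orbT => /(_ isT).
  by rewrite negb_or => /andP[].
- move=> /andP[ok1 ok2] /allP st.
  have [||t1 e1 l1] := IH1 s => //.
    apply/allP => x xc; have := st x; rewrite !mem_cat xc => /(_ isT).
    by rewrite negb_or => /andP[].
  have [||t2 e2 l2] := IH2 s => //.
    apply/allP => x xc; have := st x; rewrite !mem_cat xc orbT => /(_ isT).
    by rewrite negb_or => /andP[].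
  case: ifPn => E.
    exists ((cost e).+1 + t1); first exact: ExecIfTrue.
    by rewrite leq_add2l (leq_trans l1) // leq_addr.
  exists ((cost e).+1 + t2); first by apply: ExecIfFalse; rewrite // negbK in E.
  by rewrite leq_add2l (leq_trans l2) // leq_addl.
- move=> /andP[ib okb] /andP[xb /allP st].
  set s0 := set_reg s i 0; set f := for_step i (sem b).
  have fregs m y : y \notin i :: wregs b -> reg (iter m f s0) y = reg s y.
    move=> yb; have := yb; rewrite inE negb_or => /andP[/negbTE yi yb'].
    elim: m => [|m IHm] /=; first by rewrite yi.
    by rewrite yi sem_reg.
  have ireg m : reg (iter m f s0) i = m.
    by elim: m => [|m IHm] /=; rewrite eqxx // sem_reg // IHm addn1.
  (* [ExecWhileStep] unfolds a loop from its first iteration, whence the induction on the number [r]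
     of iterations still to run. *)
  have H r : r <= reg s x -> exists2 t,
     exec (While (Sub (Reg x) (Reg i))
           (Seq (compile b) (Assign i (Add (Reg i) (Const 1)))))
       (iter (reg s x - r) f s0) t (iter (reg s x) f s0) &
     t <= 4 + r * (tbound b s + 8).
    elim: r => [|r IHr] ler.
      rewrite subn0; exists 4 => //.
      by apply: (@ExecWhileEnd (Sub (Reg x) (Reg i))); rewrite /= fregs // ireg subnn.
    have [t2 e2 l2] := IHr (ltnW ler).
    have [||t1 e1 l1] := IH (iter (reg s x - r.+1) f s0) => //.
      by apply/allP => y yb; have := st y yb; rewrite inE negb_or => /andP[].
    exists (4 + (t1 + 4) + t2); last first.
      rewrite mulSn addnCA (addnC 4 (_ + _)) -addnA (addnC _ 4).
      have : tbound b (iter (reg s x - r.+1) f s0) = tbound b s.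
        by apply: tbound_eq => y yb; rewrite fregs // st.
      lia.
    apply: (@ExecWhileStep (Sub (Reg x) (Reg i))) e2.
      by rewrite /= fregs // ireg; lia.
    have -> : reg s x - r = (reg s x - r.+1).+1 by lia.
    exact: (ExecSeq e1 (ExecAssign _ i (Add (Reg i) (Const 1)))).
  have [t e l] := H _ (leqnn _).
  exists (2 + t); last by lia.
  rewrite subnn in e.
  exact: ExecSeq (ExecAssign s i (Const 0)) e.
Qed.

(** Deliberately crude: the bounds of consecutive loops are multiplied as if the loops were nested.
    This only raises the exponent of polynomial factors, as long as each superpolynomial bound
    occurs once. *)
Lemma tbound_le c s :
  tbound c s <= psize c * \prod_(x <- bounds c) (reg s x).+1.
Proof.
elim: c => [|y e|a e1 e2|c1 IH1 c2 IH2|e c1 IH1 c2 IH2|i y b IH] /=;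
  rewrite ?big_nil ?muln1 // ?big_cat ?big_cons /=.
- have P1 : 0 < \prod_(x <- bounds c1) (reg s x).+1 by apply: prodn_gt0.
  have P2 : 0 < \prod_(x <- bounds c2) (reg s x).+1 by apply: prodn_gt0.
  by nia.
- have P1 : 0 < \prod_(x <- bounds c1) (reg s x).+1 by apply: prodn_gt0.
  have P2 : 0 < \prod_(x <- bounds c2) (reg s x).+1 by apply: prodn_gt0.
  move: IH1 IH2; move: (\prod_(x <- _) _) P1 => A A0.
  move: (\prod_(x <- _) _) P2 => B B0 IH1 IH2.
  have : psize c1 * A <= psize c1 * (A * B) by rewrite leq_mul2l leq_pmulr ?orbT.
  have : psize c2 * B <= psize c2 * (A * B) by rewrite leq_mul2l leq_pmull ?orbT.
  have : (cost e).+1 <= (cost e).+1 * (A * B) by rewrite leq_pmulr ?muln_gt0 ?A0.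
  lia.
- have P2 : 0 < \prod_(x <- bounds b) (reg s x).+1 by apply: prodn_gt0.
  move: IH; move: (\prod_(x <- _) _) P2 => A A0 IH.
  have : reg s y * (tbound b s + 8) <= reg s y * ((psize b + 8) * A).
    by rewrite leq_mul2l mulnDl leq_add ?orbT // leq_pmulr.
  have : 8 <= (psize b + 8) * A by nia.
  lia.
Qed.

(** * Mixed radix numeration *)

Definition digit (r : nat -> nat) (t i : nat) : nat :=
  (t %/ \prod_(j < i) r j) %% r i.

(** A carry reaches position [i] exactly when all lower digits wrap around, that is when the product
    of the lower radices divides [t.+1]. *)
Lemma digitS (r : nat -> nat) t i :
  0 < \prod_(j < i) r j ->
  digit r t.+1 i =
    if \prod_(j < i) r j %| t.+1 then
      if (digit r t i).+1 == r i then 0 else (digit r t i).+1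
    else digit r t i.
Proof.
move=> P0; rewrite /digit divnS //.
case: ifP => // _; rewrite add1n modnS.
case: (posnP (r i)) => [->|ri0]; first by rewrite !modn0.
case: ifP => D; case: ifP => // E; exfalso.
  move: D E; set y := _ %/ _ => D E.
  have := D; rewrite (divn_eq y (r i)) -addnS dvdn_addr ?dvdn_mull //.
  by move/(dvdn_leq (ltn0Sn _)); have := ltn_pmod y ri0; lia.
move: D E; set y := _ %/ _ => D /eqP E.
by move: D; rewrite (divn_eq y (r i)) -addnS E dvdn_addr ?dvdn_mull ?dvdnn.
Qed.

(** Propagation of the carry: it leaves position [i] when it arrives there and finds the digit at
    its maximum. *)
Lemma dvdn_digit (r : nat -> nat) t i :
  0 < \prod_(j < i.+1) r j ->
  (\prod_(j < i.+1) r j %| t.+1) =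
    (\prod_(j < i) r j %| t.+1) && ((digit r t i).+1 == r i).
Proof.
rewrite big_ord_recr /= muln_gt0 => /andP[P0 ri0].
set P := \prod_(j < i) r j in P0 *; rewrite /digit -/P.
case: (boolP (P %| t.+1)) => D /=; last first.
  by apply/negbTE; apply: contra D => D; rewrite (dvdn_trans _ D) ?dvdn_mulr.
have -> : (P * r i %| t.+1) = (r i %| (t %/ P).+1).
  have := divnS t P0; rewrite D add1n => <-.
  by rewrite mulnC -[in LHS](divnK D) dvdn_pmul2r.
set y := _ %/ _.
rewrite [in LHS](divn_eq y (r i)) -addnS dvdn_addr ?dvdn_mull //.
apply/idP/eqP => [/(dvdn_leq (ltn0Sn _))|->]; last exact: dvdnn.
by have := ltn_pmod y ri0; lia.
Qed.

(** This is why a counter running below the product of the radices tries every admissible word of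
    digits. *)
Lemma digit_surj L (r v : nat -> nat) :
  (forall i, i < L -> v i < r i) ->
  exists2 t, t < \prod_(j < L) r j & forall i, i < L -> digit r t i = v i.
Proof.
elim: L => [|L IH] H; first by exists 0 => //; rewrite big_ord0.
have [t lt dt] := IH (fun i li => H i (leqW li)).
exists (v L * \prod_(j < L) r j + t).
  rewrite big_ord_recr /= (@leq_trans ((v L).+1 * \prod_(j < L) r j)) //.
    by rewrite mulSn addnC ltn_add2r.
  by rewrite mulnC leq_mul2l H ?orbT.
move=> i; rewrite ltnS leq_eqVlt => /orP[/eqP->|li].
  rewrite /digit divnMDl; last by apply: leq_ltn_trans lt.
  by rewrite divn_small // addn0 modn_small // H.
rewrite -(dt _ li) /digit.
(* Splitting the product at [i] shows the new top summand to be a multiple of the weight of digit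
   [i] times [r i], so it does not affect that digit. *)
have -> : \prod_(j < L) r j =
    \prod_(j < i) r j * (r i * \prod_(i.+1 <= j < L) r j).
  rewrite -!(big_mkord xpredT r) (big_cat_nat (n := i)) ?(ltnW li) //=.
  by rewrite [in X in _ * X = _]big_ltn.
set Q := \prod_(i.+1 <= j < L) _; set P := \prod_(j < i) _.
case: (posnP P) => [P_0|P0]; first by rewrite P_0 !divn0.
have -> : v L * (P * (r i * Q)) = v L * Q * r i * P by lia.
by rewrite divnMDl // modnMDl.
Qed.

(** * Multiplicative hashing *)

Definition hash (R w a x : nat) : nat := ((a * x) %% (R * w)) %/ w.

(** Two residues in the same block of length [w] differ by less than [w], so [a * (y - x)] is within
    [w] of a multiple of [R * w]. Adding [w] keeps the window inside the natural numbers. *)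
Lemma collision_window R w a x y :
  0 < w -> x < y -> hash R w a x = hash R w a y ->
  (a * (y - x) + w) %% (R * w) < 2 * w.
Proof.
move=> w0 ltxy; rewrite /hash; set M := R * w => E.
have Ex := divn_eq ((a * x) %% M) w; have Ey := divn_eq ((a * y) %% M) w.
have lx := ltn_pmod ((a * x) %% M) w0; have ly := ltn_pmod ((a * y) %% M) w0.
rewrite E in Ex.
set A := (a * x) %% M in Ex lx E; set B := (a * y) %% M in Ey ly E Ex.
set Q := B %/ w * w in Ex Ey.
have -> : (a * (y - x) + w) %% M = (B + w - A) %% M.
  apply/eqP; rewrite -(eqn_modDr A) subnK; last by lia.
  apply/eqP; rewrite -addnA -modnDmr (addnC w) -[(A + w) %% M]modnDml.
  rewrite /A modn_mod modnDml modnDmr addnA -mulnDr subnK; last exact: ltnW.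
  by rewrite -modnDml /B modnDml.
by apply: leq_ltn_trans (leq_mod _ _) _; lia.
Qed.

(* With [d := y - x], the multiples [a * d] meet at most [d + 1] of the windows
   of width [2 w] around the multiples of [R * w], each of them at most
   [2 w / d + 1] times. *)
Lemma card_collisions R w x y :
  0 < R -> x < y < w ->
  #|[set a : 'I_(R * w) | hash R w a x == hash R w a y]| <= 5 * w.
Proof.
move=> R0 /andP[ltxy ltyw].
have w0 : 0 < w by lia.
have M0 : 0 < R * w by rewrite muln_gt0 R0.
set M := R * w in M0 *; set d := y - x.
have d0 : 0 < d by rewrite subn_gt0.
have ltdw : d < w by rewrite /d; lia.
pose f (a : 'I_M) : 'I_d.+1 * 'I_(2 * w %/ d).+1 :=
  (inord ((a * d + w) %/ M), inord ((a * d + w) %% M %/ d)).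
set S := [set a | _].
(* Changing [a] moves [a * d + w] by at least [d], so the window together with the stretch of length
   [d] inside it determines [a]. *)
have inj : {in S &, injective f}.
  move=> a a'; rewrite !inE => /eqP/(collision_window w0 ltxy) Ha.
  move=> /eqP/(collision_window w0 ltxy) Ha' [] /(congr1 val) /= H1 /(congr1 val) /= H2.
  apply: val_inj => /=.
  have B1 (c : 'I_M) : (c * d + w) %/ M < d.+1.
    rewrite ltn_divLR // mulSn.
    have : c.+1 * d <= M * d by rewrite leq_mul2r ltn_ord orbT.
    have : w <= M by rewrite /M leq_pmull.
    lia.
  have B2 c : (c * d + w) %% M < 2 * w -> (c * d + w) %% M %/ d < (2 * w %/ d).+1.
    by move=> H; rewrite ltnS leq_div2r // ltnW.
  rewrite !inordK // in H1; rewrite !inordK ?B2 // in H2.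
  have E := divn_eq (a * d + w) M; have E' := divn_eq (a' * d + w) M.
  have F := divn_eq ((a * d + w) %% M) d; have F' := divn_eq ((a' * d + w) %% M) d.
  have L := ltn_pmod ((a * d + w) %% M) d0; have L' := ltn_pmod ((a' * d + w) %% M) d0.
  rewrite H1 in E; rewrite H2 in F.
  move: E E' F F' L L'; move: (_ %% M) (_ %% M) => m m'.
  move: (m %% d) (m' %% d) (_ %/ M) (_ %/ d) => r r' u v E E' F F' L L'.
  case: (ltngtP a a') => // lt; exfalso.
    have : a.+1 * d <= a' * d by rewrite leq_mul2r lt orbT.
    by rewrite mulSn; clear -E E' F F' L L'; lia.
  have : a'.+1 * d <= a * d by rewrite leq_mul2r lt orbT.
  by rewrite mulSn; clear -E E' F F' L L'; lia.
rewrite -(card_in_imset inj).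
apply: leq_trans (max_card _) _; rewrite card_prod !card_ord.
(* As [1 <= d < w], [(d + 1) * (2 * w %/ d + 1) <= 2 * w + d + 2 * w + 1 <= 5 * w]. *)
have := leq_trunc_div (2 * w) d; nia.
Qed.

Definition collides (R w a : nat) (F : {set 'I_w}) : {set 'I_w} :=
  [set x in F | [exists y in F, (y != x) && (hash R w a x == hash R w a y)]].

(** Averaging over the multipliers. If each of them had 41 colliding elements, the total would be at
    least [41 * R * w]; but there are at most [q * q] ordered pairs, each charged [5 * w], and
    [q.+1 <= 8 * b] gives [5 * q ^ 2 <= 40 * R]. *)
Lemma few_collisions w q b (F : {set 'I_w}) :
  0 < w -> #|F| <= q -> q < 8 * b ->
  exists2 a, a < q.+1 * b * w & #|collides (q.+1 * b) a F| <= 40.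
Proof.
move=> w0 Fq qb; set R := q.+1 * b; set M := R * w.
have R0 : 0 < R by rewrite /R; nia.
case: (boolP [exists a : 'I_M, #|collides R a F| <= 40]) => [/existsP[a Ha]|].
  by exists a.
rewrite negb_exists => /forallP many; exfalso.
have lower : 41 * M <= \sum_(a < M) #|collides R a F|.
  rewrite -[M in 41 * M]card_ord mulnC -sum_nat_const.
  by apply: leq_sum => a _; rewrite ltnNge many.
have upper : \sum_(a < M) #|collides R a F| <= q * (q * (5 * w)).
  have H a : #|collides R a F| <=
      \sum_(x in F) \sum_(y in F | y != x) (hash R w a x == hash R w a y).
    rewrite -sum1_card /collides big_mkcond [leqRHS]big_mkcond /=.
    apply: leq_sum => x _; rewrite inE; case: (x \in F) => //=.
    case: existsP => //= -[y /and3P[yF yx E]].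
    by rewrite (bigD1 y) ?yF //= E.
  have /leq_trans-> // : \sum_(a < M) #|collides R a F| <= \sum_(a < M)
      \sum_(x in F) \sum_(y in F | y != x) (hash R w a x == hash R w a y).
    by apply: leq_sum => a _; apply: H.
  rewrite exchange_big /=.
  apply: (@leq_trans (\sum_(x in F) q * (5 * w))); last first.
    by rewrite sum_nat_const leq_mul2r Fq orbT.
  apply: leq_sum => x xF; rewrite exchange_big /=.
  apply: (@leq_trans (\sum_(y in F | y != x) 5 * w)); last first.
    rewrite sum_nat_cond_const leq_mul2r; apply/orP; right.
    by apply: leq_trans Fq; apply/subset_leq_card/subsetP => y /[!inE] /andP[].
  apply: leq_sum => y /andP[yF yx].
  apply: leq_trans (_ : #|[set a : 'I_M | hash R w a x == hash R w a y]| <= _).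
    rewrite -sum1_card [leqRHS]big_mkcond /=.
    by apply: leq_sum => a _; rewrite inE; case: (_ == _).
  have [lt|lt|/val_inj E] := ltngtP x y; last by rewrite E eqxx in yx.
    by apply: card_collisions => //; rewrite lt /=.
  have : #|[set a : 'I_M | hash R w a y == hash R w a x]| <= 5 * w.
    by apply: card_collisions => //; rewrite lt /=.
  by congr (_ <= _); apply: eq_card => a; rewrite !inE eq_sym.
have := leq_trans lower upper.
rewrite /M !mulnA leq_pmul2r // => H.
have : q.+1 * q.+1 <= q.+1 * (8 * b) by rewrite leq_mul2l qb orbT.
by rewrite mulnCA -/R; move: H; clear; lia.
Qed.

(** * Enumerating partial tables *)

(* A word of digits drives a writing head over a table with rows of width [b]:
   a digit 0 moves the head at [p] to the next row, a nonzero digit writes the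
   next color [C j] in column [B j] of the current row. *)
Definition tab_step (b : nat) (B C : nat -> nat)
    (st : nat * nat * (nat -> nat)) (d : nat) : nat * nat * (nat -> nat) :=
  let: (p, j, T) := st in
  if d != 0 then (p, j.+1, fun z => if z == p + B j then C j else T z)
  else (p + b, j, T).

Lemma tab_step_skip b B C p j T n :
  foldl (tab_step b B C) (p, j, T) (nseq n 0) = (p + n * b, j, T).
Proof.
elim: n p => [|n IH] p /=; first by rewrite addn0.
by rewrite IH mulSn addnA.
Qed.

(** Since [l] is sorted, the head never has to move back: one nonzero digit per cell and [m] zeros
    for the rows suffice. The word depends on [l] only; [B], [C] and [j0] come after it, so that the
    induction can shift the position from which columns and colors are read. *)
Lemma tab_word b l r0 m :
  0 < b -> sorted leq l -> all (fun z => r0 <= z %/ b <= r0 + m) l ->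
  exists ws, [/\ size ws = size l + m, all (fun d => d < 2) ws &
    forall B C cc T j0,
      (forall i, i < size l -> B (j0 + i) = nth 0 l i %% b) ->
      (forall i, i < size l -> C (j0 + i) = cc (nth 0 l i)) ->
      forall z, (foldl (tab_step b B C) (r0 * b, j0, T) ws).2 z =
                if z \in l then cc z else T z].
Proof.
move=> b0; elim: l r0 m => [|x l IH] r0 m.
  move=> _ _; exists (nseq m 0); split; first by rewrite size_nseq.
    by rewrite all_nseq orbT.
  by move=> B C cc T j0 _ _ z; rewrite tab_step_skip.
move=> srt /= /andP[/andP[x1 x2] al].
have srtl : sorted leq l by apply: path_sorted srt.
have lex z : z \in l -> x <= z.
  by move: srt; rewrite /= (path_sortedE leq_trans) => /andP[/allP H _] /H.
(* The head first advances to the row of [x]; the remaining cells start in that row, with the row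
   changes already made deducted from [m]. *)
have [|ws [sz wsd wsP]] := IH (x %/ b) (m - (x %/ b - r0)) srtl.
  apply/allP => z zl; have := allP al z zl => /andP[_ z2].
  by rewrite leq_div2r ?lex //=; lia.
exists (nseq (x %/ b - r0) 0 ++ 1 :: ws); split.
- by rewrite size_cat size_nseq /= sz; lia.
- by rewrite all_cat all_nseq orbT /= wsd.
move=> B C cc T j0 HB HC z.
rewrite foldl_cat tab_step_skip -mulnDl subnKC //=.
have HB0 := HB 0 isT; have HC0 := HC 0 isT; rewrite addn0 /= in HB0 HC0.
rewrite HB0 HC0 -divn_eq (wsP _ _ cc).
- by rewrite inE; case: (z \in l); rewrite ?orbT // orbF; case: eqP => [->|].
- by move=> i il; rewrite addSnnS HB.
- by move=> i il; rewrite addSnnS HC.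
Qed.

(* The number of exceptional edges, the bound of [few_collisions]. *)
Definition nexc : nat := 40.

Lemma nexc_ge : 40 <= nexc.
Proof. by []. Qed.

Opaque nexc.

(* The digits are: the quotient and the remainder by [w] of the multiplier of the
   hash function, the exceptional edges, their colors, and then the bits, the
   columns and the colors that drive [tab_step]. *)
Definition radices (w k q b : nat) : seq nat :=
  [:: q.+1 * b; w] ++ nseq nexc w ++ nseq nexc k ++ nseq (2 * q) 2
    ++ nseq q b ++ nseq q k.

Definition offW : nat := 2 + nexc + nexc.
Definition offB (q : nat) : nat := offW + 2 * q.
Definition offC (q : nat) : nat := offB q + q.

Definition table (q b : nat) (v : nat -> nat) (T : nat -> nat) : nat -> nat :=
  (foldl (tab_step b (fun j => v (offB q + j)) (fun j => v (offC q + j)))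
     (0, 0, T) (mkseq (fun i => v (offW + i)) (2 * q))).2.

(** Every listed exceptional color must be right, since [p_exc] writes them all after hashing. The
    initial table [T] is arbitrary because the program does not clear the table between two
    rounds. *)
Definition good_digits w q b (F : {set 'I_w}) (col v : nat -> nat) : Prop :=
  (forall i, i < nexc -> v (2 + nexc + i) = col (v (2 + i))) /\
  (forall x : 'I_w, x \in F ->
     (exists2 i, i < nexc & v (2 + i) = x) \/
     (forall T, table q b v T (hash (q.+1 * b) w (v 0 * w + v 1) x) = col x)).

Lemma all2_cat (S T : Type) (r : S -> T -> bool) s1 s2 t1 t2 :
  size s1 = size t1 ->
  all2 r (s1 ++ s2) (t1 ++ t2) = all2 r s1 t1 && all2 r s2 t2.
Proof. by move=> E; rewrite !all2E zip_cat // all_cat !size_cat E eqn_add2l andbACA eqxx. Qed.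

Lemma nth_skip (T : Type) (x0 : T) s t m i :
  size s = m -> nth x0 (s ++ t) (m + i) = nth x0 t i.
Proof. by move=> <-; rewrite nth_cat ltnNge leq_addr /= addKn. Qed.

Lemma all2_mkseq_nseq (f : nat -> nat) n c :
  (forall i, i < n -> f i < c) -> all2 ltn (mkseq f n) (nseq n c).
Proof.
move=> H; rewrite all2E size_mkseq size_nseq eqxx /=.
apply/(all_nthP (0, 0)) => i; rewrite size_zip size_mkseq size_nseq minnn => lt.
by rewrite nth_zip ?size_mkseq ?size_nseq // nth_mkseq // nth_nseq lt /= H.
Qed.

Lemma size_radices w k q b : size (radices w k q b) = offC q + q.
Proof. by rewrite /radices /offC /offB /offW /= !size_cat !size_nseq; lia. Qed.

(** The conclusion covers every [v'] agreeing with [v] on the digits, because the digit array of the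
    program is controlled only up to its length. *)
Lemma good_digits_exist w k q b (F : {set 'I_w}) (col : nat -> nat) :
  0 < w -> 0 < k -> #|F| <= q -> q < 8 * b -> (forall x, col x < k) ->
  exists2 v, forall i, i < size (radices w k q b) ->
      v i < nth 0 (radices w k q b) i
    & forall v', (forall i, i < size (radices w k q b) -> v' i = v i) ->
        good_digits q b F col v'.
Proof.
move=> w0 k0 Fq qb colk.
have b0 : 0 < b by lia.
have [a aM exca] := few_collisions w0 Fq qb.
set R := q.+1 * b in aM exca.
set exc := [seq val x | x <- enum (collides R a F)].
have sexc : size exc <= nexc by rewrite size_map -cardE (leq_trans exca nexc_ge).
set F' := F :\: collides R a F.
have inj x y : x \in F' -> y \in F' -> hash R w a x = hash R w a y -> x = y.
  rewrite !inE => /andP[/[swap] xF]; rewrite xF /= negb_exists.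
  move=> /forallP/(_ y) + /andP[_ yF] E; rewrite yF E eqxx andbT /= negbK.
  by move/eqP.
set l := sort leq [seq hash R w a (val x) | x <- enum F'].
have sl : size l <= q.
  rewrite size_sort size_map -cardE (leq_trans _ Fq) //.
  by apply/subset_leq_card/subsetP => x; rewrite inE => /andP[].
have inl z : z \in l -> z < R.
  rewrite mem_sort => /mapP[x _ ->]; rewrite /hash ltn_divLR //.
  by rewrite ltn_pmod // muln_gt0 w0 /R muln_gt0 b0.
pose cc z := if [pick x in F' | hash R w a x == z] is Some x then col x else 0.
have cck z : cc z < k by rewrite /cc; case: pickP.
(* As [size l <= q], a word of [2 * q] bits keeps at least [q] zeros, enough to reach the last of
   the [q.+1] rows. *)
have [||ws [sws dws wsP]] := @tab_word b l 0 (2 * q - size l) b0.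
- exact/sort_sorted/leq_total.
- apply/allP => z /inl; rewrite /R => zR; rewrite leq0n add0n /=.
  have : z %/ b < q.+1 by rewrite ltn_divLR.
  by move: sl; clear; lia.
have {}sws : size ws = 2 * q by move: sl sws; clear; lia.
(* If fewer than [nexc] edges are exceptional, the list is padded with the index 0; its color digit
   is then [col 0], so the padding writes a correct color too. *)
set vs := [:: a %/ w; a %% w] ++ mkseq (fun i => nth 0 exc i) nexc
   ++ mkseq (fun i => col (nth 0 exc i)) nexc ++ mkseq (nth 0 ws) (2 * q)
   ++ mkseq (fun i => nth 0 l i %% b) q ++ mkseq (fun i => cc (nth 0 l i)) q.
have small : all2 ltn vs (radices w k q b).
  rewrite /vs /radices.
  rewrite !all2_cat ?size_mkseq ?size_nseq //= !andbT.
  rewrite ltn_divLR // aM ltn_pmod //=.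
  apply/and5P; split; apply: all2_mkseq_nseq => i li //.
  - have [lt|ge] := ltnP i (size exc); last by rewrite nth_default.
    by have /mapP[x _ ->] := mem_nth 0 lt; apply: ltn_ord.
  - have [lt|ge] := ltnP i (size ws); last by rewrite nth_default.
    by have /(allP dws) := mem_nth 0 lt.
  - by rewrite ltn_pmod.
have szvs : size vs = size (radices w k q b).
  by move: small; rewrite all2E => /andP[/eqP].
exists (nth 0 vs).
  move=> i li; move: small; rewrite all2E => /andP[_ H].
  have li' : i < size (zip vs (radices w k q b)) by rewrite size_zip szvs minnn.
  by have := all_nthP (0, 0) H i li'; rewrite nth_zip.
have vE i : i < nexc -> nth 0 vs (2 + i) = nth 0 exc i.
  by move=> li; rewrite nth_skip // nth_cat size_mkseq li nth_mkseq.
have vEC i : i < nexc -> nth 0 vs (2 + nexc + i) = col (nth 0 exc i).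
  move=> li; rewrite -addnA nth_skip // nth_skip ?size_mkseq //.
  by rewrite nth_cat size_mkseq li nth_mkseq.
have vO i : nth 0 vs (offW + i) = nth 0 (mkseq (nth 0 ws) (2 * q)
   ++ mkseq (fun i => nth 0 l i %% b) q ++ mkseq (fun i => cc (nth 0 l i)) q) i.
  by rewrite /offW -!addnA nth_skip.
have vW i : i < 2 * q -> nth 0 vs (offW + i) = nth 0 ws i.
  by move=> li; rewrite vO nth_cat size_mkseq li nth_mkseq.
have vB i : i < q -> nth 0 vs (offB q + i) = nth 0 l i %% b.
  move=> li; rewrite /offB -(addnA offW) vO (nth_skip _ _ _ (size_mkseq _ _)).
  by rewrite nth_cat size_mkseq li nth_mkseq.
have vC i : i < q -> nth 0 vs (offC q + i) = cc (nth 0 l i).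
  move=> li; rewrite /offC /offB -2!(addnA offW) -(addnA (2 * q)) vO.
  by rewrite !(nth_skip _ _ _ (size_mkseq _ _)) nth_mkseq.
move=> v' v'E; rewrite size_radices in v'E.
split=> [i li|x xF].
  by rewrite !v'E ?vEC ?vE // /offC /offB /offW; lia.
have {}vE i : i < nexc -> v' (2 + i) = nth 0 exc i.
  by move=> li; rewrite v'E ?vE // /offC /offB /offW; lia.
have {}vW i : i < 2 * q -> v' (offW + i) = nth 0 ws i.
  by move=> li; rewrite v'E ?vW // /offC /offB; lia.
have {}vB i : i < q -> v' (offB q + i) = nth 0 l i %% b.
  by move=> li; rewrite v'E ?vB // /offC; lia.
have {}vC i : i < q -> v' (offC q + i) = cc (nth 0 l i).
  by move=> li; rewrite v'E ?vC //; lia.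
case: (boolP (x \in collides R a F)) => xc.
  left; have xe : val x \in exc by rewrite map_f ?mem_enum.
  have li : index (val x) exc < nexc by rewrite (leq_trans _ sexc) ?index_mem.
  by exists (index (val x) exc); last by rewrite vE ?nth_index.
have xF' : x \in F' by rewrite inE xc.
right=> T; rewrite /table.
have -> : mkseq (fun i => v' (offW + i)) (2 * q) = ws.
  apply: (@eq_from_nth _ 0); rewrite size_mkseq // => i li.
  by rewrite nth_mkseq // vW.
have -> : v' 0 * w + v' 1 = a.
  by rewrite !v'E -?divn_eq // /offC /offB /offW; lia.
have := wsP (fun j => v' (offB q + j)) (fun j => v' (offC q + j)) cc T 0.
rewrite mul0n => ->.
- have -> : hash R w a x \in l.
    by rewrite mem_sort; apply/mapP; exists x; rewrite ?mem_enum.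
  rewrite /cc; case: pickP => [y /andP[yF' /eqP E]|].
    by rewrite (inj _ _ xF' yF').
  by move/(_ x); rewrite xF' eqxx.
- by move=> i li; rewrite add0n vB // (leq_trans li).
- by move=> i li; rewrite add0n vC // (leq_trans li).
Qed.

(** * Rainbow walks and sets of colors *)

Lemma sum_pow2_lt c cs :
  uniq cs -> all (fun i => i < c) cs -> \sum_(i <- cs) 2 ^ i < 2 ^ c.
Proof.
elim: c cs => [|c IH] cs Ucs Lcs.
  case: cs Lcs {Ucs} => [|i cs] //=; by rewrite big_nil.
have Lrem s : c \notin s -> all (fun i => i < c.+1) s ->
    all (fun i => i < c) s.
  move=> cs' /allP H; apply/allP => i ics.
  have := H i ics; rewrite ltnS leq_eqVlt => /orP[/eqP E|//].
  by rewrite -E ics in cs'.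
rewrite expnS mul2n -addnn.
have [cin|cout] := boolP (c \in cs); last first.
  by apply: ltn_addr; apply: IH => //; apply: Lrem.
rewrite (perm_big _ (perm_to_rem cin)) big_cons ltn_add2l.
have U : uniq (rem c cs) by rewrite rem_uniq.
apply: IH => //; apply: Lrem; first by rewrite mem_rem_uniqF.
by apply/allP => i /mem_rem; apply: (allP Lcs).
Qed.

(** The exponents below [c] contribute less than [2 ^ c], those above [c] a multiple of [2 ^ c.+1]:
    bit [c] of the sum is clear. *)
Lemma sum_pow2_even c cs :
  uniq cs -> c \notin cs -> ~~ odd ((\sum_(i <- cs) 2 ^ i) %/ 2 ^ c).
Proof.
move=> Ucs ccs; rewrite (bigID (fun i => i < c)) /=.
have lt : \sum_(i <- cs | i < c) 2 ^ i < 2 ^ c.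
  rewrite -big_filter; apply: sum_pow2_lt; first exact: filter_uniq.
  by apply/allP => i; rewrite mem_filter => /andP[].
have /dvdnP[y ->] : 2 ^ c.+1 %| \sum_(i <- cs | ~~ (i < c)) 2 ^ i.
  rewrite big_seq_cond.
  apply: (big_ind (fun z => 2 ^ c.+1 %| z)) => [|x y|i /andP[ics ci]].
  - exact: dvdn0.
  - exact: dvdn_add.
  apply: dvdn_exp2l; rewrite ltn_neqAle leqNgt ci andbT.
  by apply: contra ccs => /eqP ->.
by rewrite addnC expnS mulnA divnMDl ?expn_gt0 // divn_small // addn0 oddM andbF.
Qed.

(* Vertices are natural numbers, and [u * n + v] is the index of the arc from
   [u] to [v] in the row-major order. *)
Definition walk_colors (n : nat) (cf : nat -> nat) (u : nat) (p : seq nat) :=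
  pairmap (fun x y => cf (x * n + y)) u p.

(** Vertices may repeat: cutting out closed subwalks keeps the colors distinct, so the dynamic
    program has to remember colors only. Colors are bounded along the walk, not globally, so any
    function [cf] is a legal coloring to test. *)
Definition rainbow_walk (n : nat) (adj : pred nat) (cf : nat -> nat) (k : nat)
    (u v : nat) (p : seq nat) : Prop :=
  [/\ path (fun x y => (y < n) && adj (x * n + y)) u p, last u p = v,
      uniq (walk_colors n cf u p) & all (fun c => c < k) (walk_colors n cf u p)].

(* The set of the colors of the walk is encoded by the sum [m] of the [2 ^ c]. *)
Definition reachable n adj cf k u m v : Prop :=
  exists2 p, rainbow_walk n adj cf k u v p
           & \sum_(c <- walk_colors n cf u p) 2 ^ c = m.

Lemma reachable_bound n adj cf k u v :
  (exists p, rainbow_walk n adj cf k u v p) <->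
  exists2 m, m < 2 ^ k & reachable n adj cf k u m v.
Proof.
split=> [[p W]|[m _ [p W _]]]; last by exists p.
exists (\sum_(c <- walk_colors n cf u p) 2 ^ c); last by exists p.
by case: W => _ _ U A; apply: sum_pow2_lt.
Qed.

(** The recurrence of the dynamic program, by the last arc [x] of the walk; the parity test asks
    whether the color of [x] belongs to the set encoded by [m]. *)
Lemma reachable_rec n (adj : pred nat) cf k u m v : u < n -> v < n ->
  reachable n adj cf k u m v <->
  (m = 0 /\ v = u) \/
  exists2 x, [/\ x < n * n, x %% n = v, adj x & cf x < k]
           & odd (m %/ 2 ^ cf x) /\ reachable n adj cf k u (m - 2 ^ cf x) (x %/ n).
Proof.
move=> un vn; have n0 : 0 < n by apply: leq_ltn_trans un.
split=> [[p [P L U A] S]|[[-> ->]|[x [xn xv ax cx] [ox [p [P L U A] S]]]]].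
- case/lastP: p => [|p y] in P L U A S *.
    by left; rewrite -S /walk_colors /= big_nil -L.
  move: P; rewrite rcons_path last_rcons in L * => /and3P[P yn ay].
  move: U A S; rewrite /walk_colors -cats1 pairmap_cat /= cats1.
  set a := last u p in ay *; set c := cf _.
  rewrite -/(walk_colors n cf u p) rcons_uniq all_rcons big_rcons /=.
  move=> /andP[cU U] /andP[ck A] S.
  have an : a < n.
    rewrite /a; case/lastP: p {P L U A S a ay c cU ck} (P) => [|p z] //.
    by rewrite rcons_path last_rcons => /and3P[].
  right; exists (a * n + y).
    rewrite modnMDl L modn_small // -L; split=> //.
    apply: (@leq_trans (a.+1 * n)); first by rewrite mulSn addnC ltn_add2r.
    by rewrite leq_mul2r an orbT.
  have -> : (a * n + y) %/ n = a by rewrite divnMDl // divn_small // addn0.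
  rewrite -/c -S.
  have -> : \sum_(i <- walk_colors n cf u p) 2 ^ i + 2 ^ c =
            1 * 2 ^ c + \sum_(i <- walk_colors n cf u p) 2 ^ i by lia.
  rewrite divnMDl ?expn_gt0 // add1n /= sum_pow2_even // mul1n addKn; split=> //.
  by exists p.
- by exists [::]; rewrite /walk_colors /= ?big_nil.
have Ex : x = x %/ n * n + v by rewrite -xv -divn_eq.
have c2 : 2 ^ cf x <= m.
  by case: leqP ox => // lt; rewrite divn_small.
exists (rcons p v); last first.
  by rewrite /walk_colors -cats1 pairmap_cat big_cat /= L -Ex S big_cons big_nil; lia.
rewrite /rainbow_walk /walk_colors -cats1 pairmap_cat cat_path last_cat /= L -Ex.
rewrite P vn ax cats1 rcons_uniq all_rcons cx A U !andbT; split=> //.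
apply/negP => /= cin.
(* If the color [c] of the last arc already occurred, the sum for [p] would be [2 ^ c + s] with bit
   [c] of [s] clear, and [m = 2 * 2 ^ c + s] would have bit [c] clear. *)
move: S; rewrite (perm_big _ (perm_to_rem cin)) big_cons /=.
have := sum_pow2_even (c := cf x) (rem_uniq (cf x) U).
rewrite mem_rem_uniqF // => /(_ isT).
move: (\sum_(_ <- _) _) => s + S.
move: ox; have -> : m = 2 * 2 ^ cf x + s by lia.
by rewrite divnMDl ?expn_gt0 // oddD => /= ->.
Qed.

(** * The program *)

Arguments sem : simpl never.

Lemma sem_seq c1 c2 s : sem (PSeq c1 c2) s = sem c2 (sem c1 s).
Proof. by []. Qed.

Lemma sem_skip s : sem PSkip s = s.
Proof. by []. Qed.

Lemma sem_assign x e s : sem (PAssign x e) s = set_reg s x (eval s e).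
Proof. by []. Qed.

Lemma sem_put a e1 e2 s :
  sem (PPut a e1 e2) s = set_arr s a (eval s e1) (eval s e2).
Proof. by []. Qed.

Lemma sem_if e c1 c2 s :
  sem (PIf e c1 c2) s = if eval s e != 0 then sem c1 s else sem c2 s.
Proof. by []. Qed.

Definition semE := (sem_seq, sem_skip, sem_assign, sem_put, sem_if).

Lemma subn_neq0 a b : (a - b != 0) = (b < a).
Proof. by rewrite subn_eq0 -ltnNge. Qed.

Notation "a ;; b" := (PSeq a b) (at level 100, right associativity).
Notation "x ::= e" := (PAssign x e) (at level 95, no associativity).
Notation "# x" := (Reg x) (at level 1, format "# x").
Infix "+e" := Add (at level 50, left associativity).
Infix "-e" := Sub (at level 50, left associativity).

Notation rN := 1 (only parsing).      (* number of vertices *)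
Notation rN2 := 2 (only parsing).     (* its square *)
Notation rPow := 3 (only parsing).    (* 2 ^ k *)
Notation rK := 4 (only parsing).      (* k *)
Notation rX := 5 (only parsing).      (* number of exceptional digits *)
Notation rOne := 6 (only parsing).
Notation rTwo := 7 (only parsing).
Notation rS := 8 (only parsing).      (* number of requests *)
Notation rQ := 9 (only parsing).      (* k * number of requests *)
Notation rB := 10 (only parsing).     (* width of a row of the table *)
Notation rR := 11 (only parsing).     (* size of the table *)
Notation rQ2 := 12 (only parsing).
Notation rL := 13 (only parsing).     (* number of digits *)
Notation rNum := 14 (only parsing).   (* product of the radices *)
Notation rOffB := 15 (only parsing).
Notation rOffC := 16 (only parsing).
Notation rAns := 17 (only parsing).

Notation aIn := 0 (only parsing).
Notation aU := 1 (only parsing).      (* tail of an arc *)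
Notation aV := 2 (only parsing).      (* head of an arc *)
Notation aSym := 3 (only parsing).    (* index of the edge of an arc *)
Notation aRad := 4 (only parsing).
Notation aDig := 5 (only parsing).
Notation aTab := 6 (only parsing).
Notation aCol := 7 (only parsing).    (* colors of the edges *)
Notation aBit := 8 (only parsing).    (* binary digits of the color set *)
Notation aTwo := 9 (only parsing).
Notation aPow := 10 (only parsing).   (* n * 2 ^ c *)
Notation aReach := 11 (only parsing).

(** * Preprocessing: arcs, requests, powers of two and radices *)

Definition p_square : prog :=
  rN2 ::= (Const 0) ;; PFor 20 rN (rN2 ::= #rN2 +e #rN).

Lemma p_squareP s : reg (sem p_square s) rN2 = reg s rN * reg s rN.
Proof.
rewrite /p_square sem_seq sem_assign; set s0 := set_reg _ _ _.
pose I m s' := reg s' rN2 = m * reg s rN.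
have : I (reg s0 rN) (sem (PFor 20 rN (rN2 ::= #rN2 +e #rN)) s0).
  apply: sem_for => // s' lt F G; rewrite /I semE /= => ->.
  by rewrite (F rN) //= mulSn addnC.
by [].
Qed.

(** The two arcs of an edge share the index of the one that goes from the smaller to the larger
    endpoint. *)
Definition sym (n x : nat) : nat :=
  if x %/ n < x %% n then x else x %% n * n + x %/ n.

(** Registers 21, 22 and 23 follow the quotient and the remainder of the arc index by [n] and the
    index of the reversed arc, without any division. *)
Definition p_arcs : prog :=
  21 ::= (Const 0) ;; 22 ::= (Const 0) ;; 23 ::= (Const 0) ;;
  PFor 20 rN2
   (PPut aU #20 #21 ;; PPut aV #20 #22 ;;
    PIf (#22 -e #21) (PPut aSym #20 #20) (PPut aSym #20 #23) ;;
    22 ::= #22 +e (Const 1) ;; 23 ::= #23 +e #rN ;;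
    PIf (#rN -e #22) PSkip (22 ::= (Const 0) ;; 21 ::= #21 +e (Const 1) ;; 23 ::= #21)).

Definition arcs_ok n s : Prop := forall x, x < n * n ->
  [/\ arr s aU x = x %/ n, arr s aV x = x %% n & arr s aSym x = sym n x].

Lemma modS n x : 0 < n -> x.+1 %% n = if n <= (x %% n).+1 then 0 else (x %% n).+1.
Proof.
move=> n0; rewrite -addn1 -modnDml addn1.
case: leqP => [le|]; last exact: modn_small.
have -> : (x %% n).+1 = n by have := ltn_pmod x n0; lia.
exact: modnn.
Qed.

Lemma divS n x : 0 < n ->
  x.+1 %/ n = if n <= (x %% n).+1 then (x %/ n).+1 else x %/ n.
Proof.
move=> n0; rewrite {1}(divn_eq x n) -addnS divnMDl //.
case: leqP => [le|]; last by move/divn_small->; rewrite addn0.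
have -> : (x %% n).+1 = n by have := ltn_pmod x n0; lia.
by rewrite divnn n0 addn1.
Qed.

Lemma p_arcsP s n : 0 < n ->
  reg s rN = n -> reg s rN2 = n * n -> arcs_ok n (sem p_arcs s).
Proof.
move=> n0 sN sN2; rewrite /p_arcs 3!sem_seq !sem_assign; set s0 := set_reg _ _ _.
set c := PFor _ _ _.
pose I m s' := [/\ reg s' 21 = m %/ n, reg s' 22 = m %% n,
   reg s' 23 = m %% n * n + m %/ n & forall x, x < m ->
  [/\ arr s' aU x = x %/ n, arr s' aV x = x %% n & arr s' aSym x = sym n x]].
have : I (reg s0 rN2) (sem c s0).
  apply: sem_for => //; first by rewrite /I /= div0n mod0n; split.
  move=> s' lt F G; rewrite /I => -[].
  have rN' : reg s' rN = n by rewrite F.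
  have [x Ex] : exists x, reg s' 20 = x by exists (reg s' 20).
  rewrite Ex in lt * => H1 H2 H3 H4.
  rewrite 2!sem_seq 2!sem_put sem_seq sem_if /= H1 H2 Ex subn_neq0 !sem_put /= Ex.
  set s1 := if _ then _ else _.
  have rs1 : reg s1 =1 reg s' by rewrite /s1; case: ifP.
  have as1 : arr s1 aU =1 arr (set_arr s' aU x (x %/ n)) aU by rewrite /s1; case: ifP.
  have as2 : arr s1 aV =1 arr (set_arr s' aV x (x %% n)) aV by rewrite /s1; case: ifP.
  have as3 : arr s1 aSym =1 arr (set_arr s' aSym x (sym n x)) aSym.
    by rewrite /s1 /sym /= H3; case: ifP.
  move: s1 rs1 as1 as2 as3 => s1 rs1 as1 as2 as3.
  rewrite 2!sem_seq !sem_assign sem_if /= !rs1 rN' H2 H3 addn1 subn_neq0.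
  rewrite !semE /=.
  have R1 : (if (x %% n).+1 < n then (x %% n).+1 else 0) = x.+1 %% n.
    by rewrite modS //; case: leqP.
  have R2 : (if (x %% n).+1 < n then x %/ n else (x %/ n).+1) = x.+1 %/ n.
    by rewrite divS //; case: leqP.
  have A y : y < x.+1 ->
    [/\ arr s1 aU y = y %/ n, arr s1 aV y = y %% n & arr s1 aSym y = sym n y].
    rewrite ltnS leq_eqVlt as1 as2 as3 /=.
    by case: eqP => [->|_] //= lty; apply: H4.
  rewrite -R1 -R2; case: ifP => E /=; rewrite ?rs1 ?H1 ?addn1; split => //.
  by rewrite mulSn addnAC (addnC (_ * _)).
by have -> : reg s0 rN2 = n * n by []; case.
Qed.

Definition p_count : prog :=
  rS ::= Const 0 ;;
  PFor 20 rN2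
    (PIf (Get aV #20 -e Get aU #20)
       (PIf (Get aIn (Const 1 +e #rN2 +e #20)) (rS ::= #rS +e Const 1) PSkip)
       PSkip).

(** The request matrix is symmetric; reading it above the diagonal counts each pair once. It starts
    after the number of vertices and the [n * n] adjacency entries. *)
Definition requested n s x : bool :=
  (x %/ n < x %% n) && (arr s aIn (1 + n * n + x) != 0).

Lemma p_countP s n : reg s rN2 = n * n -> arcs_ok n s ->
  reg (sem p_count s) rS = \sum_(x < n * n) requested n s x.
Proof.
move=> sN2 arcs; rewrite /p_count sem_seq sem_assign; set s0 := set_reg _ _ _.
set c := PFor _ _ _.
pose I m s' := reg s' rS = \sum_(x < m) requested n s x.
have : I (reg s0 rN2) (sem c s0).
  apply: sem_for => //; first by rewrite /I big_ord0.
  have -> : reg s0 rN2 = n * n by [].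
  move=> s' lt F G; rewrite /I !sem_if /= !G //= (F rN2) //= sN2 => H.
  have [-> -> _] := arcs _ lt; rewrite subn_neq0 big_ord_recr /= -H /requested.
  case: ifP => _ /=; last by rewrite addn0.
  by case: ifP => _; rewrite semE //= ?addn1 ?addn0.
by have -> : reg s0 rN2 = n * n by [].
Qed.

(** The entries [2 ^ c * n] are the distances between rows [m] and [m - 2 ^ c] of [aReach]; the
    constant array [aTwo] supplies the radices with which [p_incr] counts in binary. *)
Definition p_powers : prog :=
  PPut aPow (Const 0) #rN ;;
  PFor 20 rK
    (PPut aPow (#20 +e Const 1) (Get aPow #20 +e Get aPow #20) ;;
     PPut aTwo #20 (Const 2)).

Definition powers_ok n k s : Prop := forall c, c < k ->
  arr s aPow c = 2 ^ c * n /\ arr s aTwo c = 2.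

Lemma p_powersP s : powers_ok (reg s rN) (reg s rK) (sem p_powers s).
Proof.
rewrite /p_powers sem_seq sem_put; set s0 := set_arr _ _ _ _.
set c := PFor _ _ _.
pose I m s' := (forall i, i <= m -> arr s' aPow i = 2 ^ i * reg s rN) /\
   forall i, i < m -> arr s' aTwo i = 2.
have : I (reg s0 rK) (sem c s0).
  apply: sem_for => //.
    by split=> // i; rewrite leqn0 /= => /eqP ->; rewrite mul1n.
  move=> s' lt F G [H1 H2]; rewrite !semE /=; split=> i.
    rewrite leq_eqVlt /= addn1.
    by case: eqP => [-> _|_]; [rewrite H1 // addnn expnS -mul2n mulnA|exact: H1].
  by rewrite ltnS leq_eqVlt /=; case: eqP => //= _; apply: H2.
by move=> [H1 H2] i lt; rewrite H1 ?H2 // ltnW.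
Qed.

Definition p_mulk : prog :=
  rQ ::= Const 0 ;; PFor 20 rS (rQ ::= #rQ +e #rK).

Lemma p_mulkP s : reg (sem p_mulk s) rQ = reg s rK * reg s rS.
Proof.
rewrite /p_mulk sem_seq sem_assign; set s0 := set_reg _ _ _.
pose I m s' := reg s' rQ = m * reg s rK.
have : I (reg s0 rS) (sem (PFor 20 rS (rQ ::= #rQ +e #rK)) s0).
  apply: sem_for => // s' lt F G; rewrite /I semE /= => ->.
  by rewrite (F rK) //= mulSn addnC.
by rewrite mulnC.
Qed.

Definition p_width : prog :=
  rB ::= Const 1 ;; 21 ::= Const 0 ;;
  PFor 20 rQ
    (21 ::= #21 +e Const 1 ;;
     PIf (#21 -e Const 7) (21 ::= Const 0 ;; rB ::= #rB +e Const 1) PSkip).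

Lemma p_widthP s : reg (sem p_width s) rB = (reg s rQ %/ 8).+1.
Proof.
rewrite /p_width 2!sem_seq !sem_assign; set s0 := set_reg _ _ _.
set c := PFor _ _ _.
pose I m s' := reg s' rB = (m %/ 8).+1 /\ reg s' 21 = m %% 8.
have : I (reg s0 rQ) (sem c s0).
  apply: sem_for => // s' lt F G; rewrite /I !semE /= subn_neq0 addn1 => -[H1 H2].
  rewrite H1 H2 modS // divS // ltnS.
  by case: leqP => _; rewrite /= ?addn1 ?H1.
by case.
Qed.

Definition p_table_size : prog :=
  rR ::= #rB ;; PFor 20 rQ (rR ::= #rR +e #rB) ;;
  rQ2 ::= #rQ +e #rQ ;; rOffB ::= Const offW +e #rQ2 ;; rOffC ::= #rOffB +e #rQ.

Lemma p_table_sizeP s (s' := sem p_table_size s) (q := reg s rQ) :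
  [/\ reg s' rR = q.+1 * reg s rB, reg s' rQ2 = 2 * q,
      reg s' rOffB = offB q & reg s' rOffC = offC q].
Proof.
rewrite /s' /p_table_size sem_seq sem_assign sem_seq; set s0 := set_reg _ _ _.
set c := PFor _ _ _.
pose I m s' := reg s' rR = m.+1 * reg s rB.
have : I (reg s0 rQ) (sem c s0).
  apply: sem_for => //; first by rewrite /I /= mul1n.
  move=> s1 lt F G; rewrite /I !semE /= => ->.
  by rewrite (F rB) //= [in RHS]mulSn addnC.
rewrite /I => H; rewrite !semE /= H (sem_reg (c := c)) //= /offC /offB -/q.
by rewrite mul2n -addnn.
Qed.

(** Multiplication is a loop and loop bounds are registers, which is why even the constants 1 and 2
    are kept in [rOne] and [rTwo]. *)
Definition p_fill (cnt val : nat) : prog :=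
  PFor 20 cnt
    (PPut aRad #rL #val ;; rL ::= #rL +e Const 1 ;; 21 ::= Const 0 ;;
     PFor 22 val (21 ::= #21 +e #rNum) ;; rNum ::= #21).

Definition radices_are (l : seq nat) (s : state) : Prop :=
  [/\ forall i, arr s aRad i = nth 0 l i, reg s rL = size l
    & reg s rNum = \prod_(r <- l) r].

Lemma p_fillP cnt val l s :
  all (fun r => r \notin [:: 20; 21; 22; rL; rNum]) [:: cnt; val] ->
  radices_are l s ->
  radices_are (l ++ nseq (reg s cnt) (reg s val)) (sem (p_fill cnt val) s).
Proof.
move=> /= /and3P[c_ok v_ok _] ls.
apply: (@sem_for 20 cnt _ s (fun m s' => radices_are (l ++ nseq m (reg s val)) s')).
- by [].
- by rewrite cats0; case: ls => H1 H2 H3; split.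
move=> s' lt F G [H1 H2 H3].
have {F}Fv : reg s' val = reg s val.
  by rewrite F //; move: v_ok; rewrite /= !inE !negb_or; case/and5P=> -> -> -> -> ->.
rewrite 3!sem_seq sem_put 2!sem_assign sem_seq.
set s0 := set_reg (set_reg _ _ _) 21 _.
pose I m s1 := reg s1 21 = m * reg s' rNum.
have : I (reg s0 val) (sem (PFor 22 val (21 ::= #21 +e #rNum)) s0).
  apply: sem_for => // s1 lt1 F G1; rewrite /I semE /= => ->.
  by rewrite (F rNum) //= mulSn addnC.
have vE : reg s0 val = reg s val.
  by move: v_ok; rewrite /= !inE !negb_or => /and5P[_ /negbTE-> _ /negbTE-> _].
rewrite /I vE; set c := PFor _ _ _ => E.
have -> : nseq (reg s' 20).+1 (reg s val) = nseq (reg s' 20) (reg s val) ++ [:: reg s val].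
  by rewrite -addn1 nseqD.
rewrite catA; split.
- move=> i; rewrite semE /= sem_arr //= Fv H2 H1.
  rewrite [in RHS]nth_cat; case: ltngtP => [lt1|gt1|->].
  + by rewrite nth_cat; case: ltnP => // le; rewrite nth_cat ltnNge le.
  + by rewrite nth_default ?(ltnW gt1) // nth_default //= subn_gt0.
  + by rewrite subnn.
- by rewrite semE /= sem_reg // /s0 /= H2 [in RHS]size_cat.
- by rewrite semE /= E big_cat big_seq1 /= -H3 mulnC.
Qed.

Definition p_radices : prog :=
  rL ::= Const 0 ;; rNum ::= Const 1 ;;
  p_fill rOne rR ;; p_fill rOne rN2 ;; p_fill rX rN2 ;; p_fill rX rK ;;
  p_fill rQ2 rTwo ;; p_fill rQ rB ;; p_fill rQ rK.

Lemma p_radicesP s w k q b :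
  (forall i, arr s aRad i = 0) ->
  reg s rOne = 1 -> reg s rTwo = 2 -> reg s rX = nexc -> reg s rN2 = w ->
  reg s rK = k -> reg s rQ = q -> reg s rQ2 = 2 * q -> reg s rB = b ->
  reg s rR = q.+1 * b ->
  radices_are (radices w k q b) (sem p_radices s).
Proof.
move=> s0 h1 h2 hX hN hK hQ hQ2 hB hR; rewrite /p_radices 2!sem_seq !sem_assign.
set s1 := set_reg _ _ _.
have r1 : radices_are [::] s1 by split=> // [i|]; rewrite /= ?s0 ?nth_nil ?big_nil.
rewrite sem_seq; have r2 := @p_fillP rOne rR _ s1 isT r1.
have f2 x : x \notin wregs (p_fill rOne rR) -> reg (sem (p_fill rOne rR) s1) x = reg s1 x.
  exact: sem_reg.
move: (sem (p_fill rOne rR) s1) r2 f2 => s2 r2 f2.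
rewrite sem_seq; have r3 := @p_fillP rOne rN2 _ s2 isT r2.
have f3 x : x \notin wregs (p_fill rOne rN2) -> reg (sem (p_fill rOne rN2) s2) x = reg s2 x.
  exact: sem_reg.
move: (sem (p_fill rOne rN2) s2) r3 f3 => s3 r3 f3.
rewrite sem_seq; have r4 := @p_fillP rX rN2 _ s3 isT r3.
have f4 x : x \notin wregs (p_fill rX rN2) -> reg (sem (p_fill rX rN2) s3) x = reg s3 x.
  exact: sem_reg.
move: (sem (p_fill rX rN2) s3) r4 f4 => s4 r4 f4.
rewrite sem_seq; have r5 := @p_fillP rX rK _ s4 isT r4.
have f5 x : x \notin wregs (p_fill rX rK) -> reg (sem (p_fill rX rK) s4) x = reg s4 x.
  exact: sem_reg.
move: (sem (p_fill rX rK) s4) r5 f5 => s5 r5 f5.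
rewrite sem_seq; have r6 := @p_fillP rQ2 rTwo _ s5 isT r5.
have f6 x : x \notin wregs (p_fill rQ2 rTwo) -> reg (sem (p_fill rQ2 rTwo) s5) x = reg s5 x.
  exact: sem_reg.
move: (sem (p_fill rQ2 rTwo) s5) r6 f6 => s6 r6 f6.
rewrite sem_seq; have r7 := @p_fillP rQ rB _ s6 isT r6.
have f7 x : x \notin wregs (p_fill rQ rB) -> reg (sem (p_fill rQ rB) s6) x = reg s6 x.
  exact: sem_reg.
move: (sem (p_fill rQ rB) s6) r7 f7 => s7 r7 f7.
have := @p_fillP rQ rK _ s7 isT r7.
rewrite !f7 // !f6 // !f5 // !f4 // !f3 // !f2 // /s1 /=.
by rewrite h1 h2 hX hN hK hQ hQ2 hB hR -!catA.
Qed.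

(* Adds one to the number with digits in [D] and radices in [A]. *)
Definition p_incr (D A len : nat) : prog :=
  48 ::= Const 1 ;;
  PFor 47 len
    (PIf #48
       (49 ::= Get D #47 +e Const 1 ;;
        PIf (Get A #47 -e #49) (PPut D #47 #49 ;; 48 ::= Const 0)
          (PPut D #47 (Const 0)))
       PSkip).

Lemma p_incrP D A len s r t :
  D != A -> len \notin [:: 47; 48; 49] ->
  (forall i, i < reg s len -> arr s A i = r i /\ 0 < r i) ->
  (forall i, i < reg s len -> arr s D i = digit r t i) ->
  forall i, i < reg s len -> arr (sem (p_incr D A len) s) D i = digit r t.+1 i.
Proof.
move=> /negbTE neq; rewrite !inE !negb_or => /and3P[/negbTE l1 /negbTE l2 /negbTE l3] sA sD.
rewrite /p_incr sem_seq sem_assign; set s0 := set_reg _ _ _.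
set c := PFor _ _ _.
have E : reg s0 len = reg s len by rewrite /= l2.
(* Register 48 is the carry; by [digitS] it must be alive at position [m] exactly when the product
   of the lower radices divides [t.+1]. *)
pose I m s' := (forall i, i < reg s len ->
   arr s' D i = if i < m then digit r t.+1 i else digit r t i) /\
   (reg s' 48 != 0) = (\prod_(j < m) r j %| t.+1).
have pos m : m <= reg s len -> 0 < \prod_(j < m) r j.
  by move=> le; apply: prodn_gt0 => j; have [] := sA j (leq_trans (ltn_ord j) le).
have : I (reg s0 len) (sem c s0).
  apply: sem_for => //.
    by split=> [i /sD|] //; rewrite big_ord0 dvd1n.
  rewrite E => s' lt F G [H1 H2].
  have [m Em] : exists m, reg s' 47 = m by exists (reg s' 47).
  rewrite Em in lt H1 H2 *.
  have sA' : arr s' A m = r m.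
    by rewrite G /= ?inE ?negb_or 1?eq_sym ?neq //; case: (sA _ lt).
  have dvd := dvdn_digit t (pos _ lt).
  have Dm : arr s' D m = digit r t m by rewrite H1 // ltnn.
  have dlt : digit r t m < r m by rewrite ltn_pmod //; case: (sA _ lt).
  have dS := digitS t (pos _ (ltnW lt)).
  rewrite sem_if /= H2; case: ifP => div; rewrite div /= in dvd dS; last first.
    split=> [i il|] /=; last by rewrite H2 div -dvd.
    rewrite H1 // ltnS [in RHS]leq_eqVlt; case: eqP => [->|_] //=.
    by rewrite ltnn dS.
  rewrite sem_seq sem_assign sem_if /= Em (sA') Dm subn_neq0 addn1.
  have cmp : ((digit r t m).+1 < r m) = ((digit r t m).+1 != r m).
    by rewrite ltn_neqAle dlt andbT.
  rewrite cmp !semE /= ?Em ?Dm ?addn1; case: eqP => e /=; split.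
  - move=> i il /=; rewrite eqxx /= ltnS [in RHS]leq_eqVlt.
    by case: eqP => [->|_] /=; [rewrite dS e eqxx|rewrite H1].
  - by rewrite /= H2 div dvd e eqxx.
  - move=> i il /=; rewrite eqxx /= ltnS [in RHS]leq_eqVlt.
    by case: eqP => [->|_] /=; [rewrite dS; case: eqP|rewrite H1].
  - by rewrite /= dvd; case: eqP.
by rewrite /I E => -[H _] i il; rewrite H // il.
Qed.

(** * From the digits to a coloring of the edges *)

Definition p_tab : prog :=
  32 ::= Const 0 ;; 33 ::= Const 0 ;;
  PFor 31 rQ2
    (PIf (Get aDig (Const offW +e #31))
       (PPut aTab (#32 +e Get aDig (#rOffB +e #33)) (Get aDig (#rOffC +e #33)) ;;
        33 ::= #33 +e Const 1)
       (32 ::= #32 +e #rB)).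

Lemma p_tabP s q b : reg s rB = b -> reg s rQ2 = 2 * q ->
  reg s rOffB = offB q -> reg s rOffC = offC q ->
  arr (sem p_tab s) aTab =1 table q b (arr s aDig) (arr s aTab).
Proof.
move=> sB sQ sOB sOC; rewrite /p_tab 2!sem_seq !sem_assign; set s0 := set_reg _ _ _.
set c := PFor _ _ _; set v := arr s aDig.
set step := tab_step b (fun j => v (offB q + j)) (fun j => v (offC q + j)).
pose I m s' :=
  let st := foldl step (0, 0, arr s aTab) (mkseq (fun i => v (offW + i)) m) in
  [/\ st.1.1 = reg s' 32, st.1.2 = reg s' 33 & arr s' aTab =1 st.2].
have : I (reg s0 rQ2) (sem c s0).
  apply: sem_for => // s' lt F G; rewrite /I mkseqS foldl_rcons.
  case: (foldl _ _ _) => -[p j] T /= [-> -> H].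
  rewrite sem_if /= G //= -/v; case: ifP => _; rewrite !semE /= /step ?addn1; split=> //.
    by move=> z; rewrite !(G aDig) //= (F rOffB) // (F rOffC) //= sOB sOC H.
  by rewrite (F rB) //= sB.
by have -> : reg s0 rQ2 = 2 * q by []; case.
Qed.

(* Registers 35 and 36 hold the quotient and the remainder by [w] of [a * x]
   modulo [R * w], so that no division is needed. *)
Definition p_hash : prog :=
  35 ::= Const 0 ;; 36 ::= Const 0 ;;
  PFor 34 rN2
    (PPut aCol #34 (Get aTab #35) ;;
     35 ::= #35 +e Get aDig (Const 0) ;; 36 ::= #36 +e Get aDig (Const 1) ;;
     PIf (#rN2 -e #36) PSkip (36 ::= #36 -e #rN2 ;; 35 ::= #35 +e Const 1) ;;
     PIf (#rR -e #35) PSkip (35 ::= #35 -e #rR)).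

(** Addition in base [w] with a carry. The high part is at most [2 * R - 1], so a single conditional
    subtraction of [R] reduces it. *)
Lemma pair_modD R w hi lo hi' lo' :
  lo < w -> lo' < w -> hi < R -> hi' < R ->
  let c := w <= lo + lo' in
  let h := hi + hi' + c in
  ((hi * w + lo) + (hi' * w + lo')) %% (R * w) =
    (if h < R then h else h - R) * w + (if c then lo + lo' - w else lo + lo').
Proof.
move=> l1 l2 h1 h2 c h; set lo2 := if c then _ else _.
have llo : lo2 < w.
  by rewrite /lo2 /c; move: l1 l2; clear; case: (leqP w (lo + lo')) => /=; lia.
have E : (hi * w + lo) + (hi' * w + lo') = h * w + lo2.
  by rewrite /h /lo2 /c !mulnDl; clear; case: (leqP w (lo + lo')) => /=; lia.
have small x : x < R -> (x * w + lo2) %% (R * w) = x * w + lo2.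
  move=> lt; apply: modn_small; apply: (@leq_trans (x.+1 * w)).
    by rewrite mulSn addnC ltn_add2r.
  by rewrite leq_mul2r lt orbT.
rewrite E; case: ltnP => [lt|le]; first exact: small.
rewrite -{1}(subnK le) mulnDl addnAC modnDr small //.
by rewrite /h; move: h1 h2; clear; case: c => /=; lia.
Qed.

Lemma p_hashP s R w a : reg s rN2 = w -> reg s rR = R ->
  arr s aDig 0 < R -> arr s aDig 1 < w ->
  a = arr s aDig 0 * w + arr s aDig 1 ->
  forall x, x < w ->
    arr (sem p_hash s) aCol x = arr s aTab (hash R w a x).
Proof.
move=> sN sR dR dw Ea; rewrite /p_hash 2!sem_seq !sem_assign; set s0 := set_reg _ _ _.
have w0 : 0 < w by apply: leq_ltn_trans dw.
set c := PFor _ _ _.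
pose I m s' := [/\ reg s' 35 * w + reg s' 36 = (a * m) %% (R * w),
  reg s' 35 < R, reg s' 36 < w &
  forall x, x < m -> arr s' aCol x = arr s aTab (hash R w a x)].
have : I (reg s0 rN2) (sem c s0).
  apply: sem_for => //.
    by rewrite /I muln0 mod0n; split=> //=; apply: leq_ltn_trans dR.
  move=> s' lt F G [H1 H2 H3 H4].
  have N : reg s' rN2 = w by rewrite F.
  have R' : reg s' rR = R by rewrite F.
  have D i : arr s' aDig i = arr s aDig i by rewrite G.
  have [m Em] : exists m, reg s' 34 = m by exists (reg s' 34).
  have [hi Eh] : exists m, reg s' 35 = m by exists (reg s' 35).
  have [lo El] : exists m, reg s' 36 = m by exists (reg s' 36).
  rewrite Em Eh El in lt H1 H2 H3 H4 *.
  have hE : hash R w a m = hi by rewrite /hash -H1 divnMDl // divn_small // addn0.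
  have := pair_modD H3 dw H2 dR; rewrite -Ea H1 /= modnDml -mulnSr.
  rewrite sem_seq sem_put 2!sem_seq !sem_assign sem_seq /= Em Eh El !D.
  rewrite G //=.
  set s1 := set_reg (set_reg (set_arr _ _ _ _) _ _) 36 _; set s2 := sem _ s1.
  set hi2 := hi + arr s aDig 0; set lo2 := lo + arr s aDig 1.
  have r35 : reg s2 35 = hi2 + (w <= lo2).
    by rewrite /s2 sem_if /= N subn_neq0; case: leqP; rewrite !semE /= ?addn0.
  have r36 : reg s2 36 = if w <= lo2 then lo2 - w else lo2.
    by rewrite /s2 sem_if /= N subn_neq0; case: leqP; rewrite !semE /= ?N.
  have a2 : arr s2 =1 arr s1 by move=> y; rewrite /s2 sem_if; case: ifP; rewrite !semE.
  have rR2 : reg s2 rR = R by rewrite /s2 sem_reg.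
  move=> E; have L36 : (if w <= lo2 then lo2 - w else lo2) < w.
    by rewrite /lo2; move: H3 dw; clear; case: (leqP w (lo + _)) => /=; lia.
  have A x : x < m.+1 -> arr s2 aCol x = arr s aTab (hash R w a x).
    rewrite ltnS leq_eqVlt a2 /s1 /=; case: eqP => [->|_] /=; [by rewrite hE|exact: H4].
  rewrite /I E sem_if /= r35 rR2 subn_neq0; case: ltnP => h; rewrite !semE /= r36.
    by rewrite r35; split.
  rewrite r35 rR2; split => //.
  by rewrite /hi2; move: H2 dR; clear; case: (w <= lo2) => /=; lia.
by have -> : reg s0 rN2 = w by []; case.
Qed.

Definition p_exc : prog :=
  PFor 37 rX
    (PPut aCol (Get aDig (Const 2 +e #37)) (Get aDig ((Const 2 +e #rX) +e #37))).

(** Entries may repeat or hit edges already colored correctly; as each entry carries the color [col]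
    of its edge, the order of the writes does not matter. *)
Lemma p_excP s (col : nat -> nat) x (v := arr s aDig) :
  (forall i, i < reg s rX -> v (2 + reg s rX + i) = col (v (2 + i))) ->
  (exists2 i, i < reg s rX & v (2 + i) = x) \/ arr s aCol x = col x ->
  arr (sem p_exc s) aCol x = col x.
Proof.
move=> Hcol Hx.
suff : (exists2 i, i < reg s rX & v (2 + i) = x) \/ arr s aCol x = col x ->
  arr (sem p_exc s) aCol x = col x by apply.
pose I m s' := (exists2 i, i < m & v (2 + i) = x) \/ arr s aCol x = col x ->
  arr s' aCol x = col x.
have : I (reg s rX) (sem p_exc s); last by [].
apply: sem_for => //; first by case=> // -[].
move=> s' lt F G H [[i]|cx]; rewrite sem_put /= !(G aDig) // (F rX) //= -/v.
  rewrite ltnS leq_eqVlt => /orP[/eqP->|li] vi.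
    by rewrite vi eqxx -vi -Hcol.
  by case: eqP => [e|_]; [rewrite e -Hcol|apply: H; left; exists i].
by case: eqP => [e|_]; [rewrite e -Hcol|apply: H; right].
Qed.

(** * Dynamic programming over sets of colors *)

(* Register 41 holds the current color set [m] and register 42 the offset [m * n]
   of its row in [aReach]. *)
Definition p_relax : prog :=
  45 ::= Get aCol (Get aSym #44) ;;
  PIf (#rK -e #45)
    (PIf (Get aBit #45)
       (PIf (Get aReach (#42 -e Get aPow #45 +e Get aU #44))
          (PPut aReach (#42 +e Get aV #44) (Const 1)) PSkip) PSkip) PSkip.

(** Row [m] depends only on the earlier rows [m - 2 ^ c], so one pass over the arcs in any order
    completes it. It is cleared first because [aReach] may hold values of an earlier run. *)
Definition p_layer : prog :=
  PFor 43 rN (PPut aReach (#42 +e #43) (Const 0)) ;;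
  PIf #41 PSkip (PPut aReach (Get aU #38) (Const 1)) ;;
  PFor 44 rN2 (PIf (Get aIn (Const 1 +e #44)) p_relax PSkip).

Definition adjacent s x : bool := arr s aIn (1 + x) != 0.
Definition edge_color n s x : nat := arr s aCol (sym n x).

Definition reach_upto n k s0 u m s : Prop := forall m' v, m' < m -> v < n ->
  (arr s aReach (m' * n + v) != 0) <->
  reachable n (adjacent s0) (edge_color n s0) k u m' v.

Lemma eq_block n m m' v v' : v < n -> v' < n ->
  (m * n + v == m' * n + v') = (m == m') && (v == v').
Proof.
move=> lv lv'; apply/eqP/andP => [E|[/eqP-> /eqP->] //].
have Em : m = m'.
  by have /(congr1 (divn^~ n)) := E; rewrite !divnMDl ?divn_small ?addn0 //; lia.
by split; apply/eqP => //; move: E; rewrite Em => /addnI.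
Qed.

Definition arc_reaches n k s u m x v : Prop :=
  [/\ x %% n = v, adjacent s x & edge_color n s x < k] /\
  odd (m %/ 2 ^ edge_color n s x) /\
  reachable n (adjacent s) (edge_color n s) k u (m - 2 ^ edge_color n s x) (x %/ n).

Lemma p_relaxP s0 s n k m :
  0 < n -> arcs_ok n s -> powers_ok n k s ->
  reg s rK = k -> reg s 42 = m * n -> reg s 44 < n * n ->
  (forall c, c < k -> arr s aBit c = odd (m %/ 2 ^ c)) ->
  arr s aCol =1 arr s0 aCol ->
  forall y, arr (sem p_relax s) aReach y =
    if [&& y == m * n + reg s 44 %% n,
           edge_color n s0 (reg s 44) < k,
           odd (m %/ 2 ^ edge_color n s0 (reg s 44)) &
           arr s aReach ((m - 2 ^ edge_color n s0 (reg s 44)) * n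
                         + reg s 44 %/ n) != 0]
    then 1 else arr s aReach y.
Proof.
move=> n0 arcs pows sK s42 lx bits cE y.
have [x Ex] : exists x, reg s 44 = x by exists (reg s 44).
rewrite Ex in lx *; have [U V S] := arcs _ lx.
rewrite /p_relax sem_seq sem_assign /= Ex S.
have -> : arr s aCol (sym n x) = edge_color n s0 x by rewrite /edge_color -cE.
set c := edge_color n s0 x; rewrite sem_if /= sK subn_neq0.
case: ltnP => ck; rewrite ?andbF // sem_if /= bits //.
case: odd; rewrite ?andbF // sem_if /= Ex U s42.
have [-> _] := pows _ ck; rewrite -mulnBl.
by case: ifP => h; rewrite semE /= ?Ex ?V ?s42 ?andbT ?andbF //; case: eqP.
Qed.

Lemma p_layerP s0 s n k u m :
  u < n -> arcs_ok n s -> powers_ok n k s ->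
  reg s rN = n -> reg s rN2 = n * n -> reg s rK = k ->
  reg s 41 = m -> reg s 42 = m * n -> arr s aU (reg s 38) = u ->
  (forall c, c < k -> arr s aBit c = odd (m %/ 2 ^ c)) ->
  arr s aCol =1 arr s0 aCol -> arr s aIn =1 arr s0 aIn ->
  reach_upto n k s0 u m s ->
  reach_upto n k s0 u m.+1 (sem p_layer s).
Proof.
move=> un arcs pows sN sN2 sK s41 s42 su bits cE iE upto.
have n0 : 0 < n by apply: leq_ltn_trans un.
rewrite /p_layer sem_seq; set c1 := PFor 43 _ _.
have C1 : (forall v, v < n -> arr (sem c1 s) aReach (m * n + v) = 0) /\
          reach_upto n k s0 u m (sem c1 s).
  pose I j s' := (forall v, v < j -> arr s' aReach (m * n + v) = 0) /\
          reach_upto n k s0 u m s'.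
  have : I (reg s rN) (sem c1 s); last by rewrite sN.
  apply: sem_for => // s' lt F G [H1 H2]; rewrite semE /= (F 42) // s42; split.
    move=> v; rewrite ltnS leq_eqVlt /= eqn_add2l.
    by case: eqP => //= _; apply: H1.
  move=> m' v lm lv /=; rewrite sN in lt.
  by rewrite eq_block // (ltn_eqF lm); apply: H2.
have R1 y : y \notin [:: 43] -> reg (sem c1 s) y = reg s y by move=> ?; rewrite sem_reg.
have A1 a : a \notin [:: aReach] -> arr (sem c1 s) a =1 arr s a by move=> ? ?; rewrite sem_arr.
move: (sem c1 s) C1 R1 A1 => s1 {c1} [Z1 U1] R1 A1.
rewrite sem_seq; set c2 := PIf #41 _ _.
have C2 : (forall v, v < n -> (arr (sem c2 s1) aReach (m * n + v) != 0) = (m == 0) && (v == u)) /\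
          reach_upto n k s0 u m (sem c2 s1).
  rewrite /c2 sem_if /= (R1 41) // s41; case: eqP => m0 /=; rewrite semE.
    rewrite /= (A1 aU) // (R1 38) // su; split.
      move=> v lv; have := Z1 v lv.
      by rewrite /= m0 mul0n add0n => ->; case: (v == u).
    by move=> m' v; rewrite m0.
  by split=> // v lv; rewrite Z1.
have R2 y : y \notin [:: 43] -> reg (sem c2 s1) y = reg s y.
  by move=> h; rewrite sem_reg // R1.
have A2 a : a \notin [:: aReach] -> arr (sem c2 s1) a =1 arr s a.
  by move=> h z; rewrite sem_arr ?A1.
move: (sem c2 s1) C2 R2 A2 => s2 {c2 U1 Z1 R1 A1 s1} [Z2 U2] R2 A2.
set c3 := PFor 44 _ _.
pose I j s' := reach_upto n k s0 u m s' /\ forall v, v < n ->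
  (arr s' aReach (m * n + v) != 0 <->
   (m = 0 /\ v = u) \/ exists2 x, x < j & arc_reaches n k s0 u m x v).
have : I (reg s2 rN2) (sem c3 s2).
  apply: sem_for => //.
    split=> // v lv; rewrite Z2 //; split=> [/andP[/eqP-> /eqP->]|]; first by left.
    by case=> [[-> ->]|[]//]; rewrite !eqxx.
  rewrite R2 // sN2 => s' lt F G [H1 H2].
  have [x Ex] : exists x, reg s' 44 = x by exists (reg s' 44).
  rewrite Ex in lt H2 *.
  set s3 := sem _ s'.
  have E3 y : arr s3 aReach y =
      if [&& y == m * n + x %% n, adjacent s0 x, edge_color n s0 x < k,
           odd (m %/ 2 ^ edge_color n s0 x) &
           arr s' aReach ((m - 2 ^ edge_color n s0 x) * n + x %/ n) != 0]
      then 1 else arr s' aReach y.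
    rewrite /s3 sem_if /= Ex G // A2 // iE -/(adjacent s0 x).
    case: ifP => ax; last by rewrite andbF.
    rewrite (@p_relaxP s0 s' n k m) ?Ex //=.
    - by move=> z lz; rewrite !G // !A2 //; apply: arcs.
    - by move=> z lz; rewrite !G // !A2 //; apply: pows.
    - by rewrite F // R2.
    - by rewrite F // R2.
    - by move=> z lz; rewrite G // A2 // bits.
    - by move=> z; rewrite G // A2.
  split.
    move=> m' v lm lv /=; rewrite E3 eq_block ?ltn_pmod //.
    by rewrite (ltn_eqF lm) /=; apply: H1.
  move=> v lv /=; rewrite E3 eq_block ?ltn_pmod // eqxx /=.
  have old : (exists2 x0, x0 < x & arc_reaches n k s0 u m x0 v) ->
             exists2 x0, x0 < x.+1 & arc_reaches n k s0 u m x0 v.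
    by case=> z lz Hz; exists z => //; apply: leqW.
  have P2 := expn_gt0 2 (edge_color n s0 x).
  (* When the color is in the set, the truncated subtraction is exact and the row consulted is
     strictly earlier, hence already correct. *)
  have le2 : odd (m %/ 2 ^ edge_color n s0 x) -> 2 ^ edge_color n s0 x <= m.
    by case: leqP => // lt2; rewrite divn_small.
  have lt2 : odd (m %/ 2 ^ edge_color n s0 x) -> m - 2 ^ edge_color n s0 x < m.
    by move/le2 => le; rewrite ltn_subrL; apply/andP; split => //; apply: leq_trans le.
  have lxn : x %/ n < n by rewrite ltn_divLR.
  case: ifP => [/and5P[/eqP vx ax ck od rc]|nope].
    split=> // _; right; exists x => //; split=> //; split=> //.
    by apply/H1 => //; apply: lt2.
  split=> [/(H2 _ lv)[h|/old h]|[h|[z]]]; [by left|by right|by apply/(H2 _ lv); left|].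
  rewrite ltnS leq_eqVlt => /orP[/eqP->|lz Hz]; last by apply/H2 => //; right; exists z.
  case=> [[vx ax ck] [od rc]]; move: nope.
  rewrite -vx eqxx ax ck od /= => E.
  by exfalso; suff: false by []; rewrite -E; apply/H1 => //; apply: lt2.
rewrite R2 // sN2 => -[H1 H2] m' v; rewrite ltnS leq_eqVlt => /orP[/eqP->|lm] lv; last exact: H1.
rewrite H2 // reachable_rec //; split; case; [by left| |by left|].
  by case=> x lx [[h1 h2 h3] h]; right; exists x.
by case=> x [h1 h2 h3 h4] h; right; exists x.
Qed.

Definition p_reach : prog :=
  40 ::= Const 0 ;; 42 ::= Const 0 ;; PFor 46 rK (PPut aBit #46 (Const 0)) ;;
  PFor 41 rPow
    (p_layer ;;
     PIf (Get aReach (#42 +e Get aV #38)) (40 ::= Const 1) PSkip ;;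
     p_incr aBit aTwo rK ;;
     42 ::= #42 +e #rN).

Lemma digit2 m c : digit (fun=> 2) m c = odd (m %/ 2 ^ c).
Proof. by rewrite /digit prod_nat_const card_ord modn2. Qed.

Lemma p_reachP s0 s n k u v :
  u < n -> v < n -> arcs_ok n s -> powers_ok n k s ->
  reg s rN = n -> reg s rN2 = n * n -> reg s rK = k -> reg s rPow = 2 ^ k ->
  arr s aU (reg s 38) = u -> arr s aV (reg s 38) = v ->
  arr s aCol =1 arr s0 aCol -> arr s aIn =1 arr s0 aIn ->
  reg (sem p_reach s) 40 != 0 <->
  exists p, rainbow_walk n (adjacent s0) (edge_color n s0) k u v p.
Proof.
move=> un vn arcs pows sN sN2 sK sP su sv cE iE.
rewrite reachable_bound /p_reach 2!sem_seq !sem_assign sem_seq.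
set s1 := set_reg _ _ _; set c1 := PFor 46 _ _.
have B1 : forall c, c < k -> arr (sem c1 s1) aBit c = 0.
  pose J m s' := forall c, c < m -> arr s' aBit c = 0.
  have : J (reg s1 rK) (sem c1 s1).
    apply: sem_for => // s' lt F G H c; rewrite semE ltnS leq_eqVlt /=.
    by case: eqP => //= _; apply: H.
  by have -> : reg s1 rK = k by [].
have R1 y : y \notin [:: 40; 42; 46] -> reg (sem c1 s1) y = reg s y.
  rewrite !inE !negb_or => /and3P[/negbTE h1 /negbTE h2 h3].
  by rewrite sem_reg /= ?h1 ?h2 ?inE.
have R40 : reg (sem c1 s1) 40 = 0 by rewrite sem_reg.
have R42 : reg (sem c1 s1) 42 = 0 by rewrite sem_reg.
have A1 a : a \notin [:: aBit] -> arr (sem c1 s1) a =1 arr s a.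
  by move=> ? ?; rewrite sem_arr.
move: (sem c1 s1) B1 R1 R40 R42 A1 => s2 {c1 s1} B2 R2 R40 R42 A2.
set c := PFor 41 _ _.
pose I m s' := [/\ reg s' 42 = m * n,
  forall c, c < k -> arr s' aBit c = odd (m %/ 2 ^ c),
  reach_upto n k s0 u m s' &
  (reg s' 40 != 0 <->
   exists2 m', m' < m & reachable n (adjacent s0) (edge_color n s0) k u m' v)].
have : I (reg s2 rPow) (sem c s2); last by rewrite R2 // sP => -[].
apply: sem_for => //.
  split=> //=; first by move=> c' lc; rewrite div0n B2.
  by rewrite R40; split=> // -[].
move=> s' lt F G [H1 H2 H3 H4].
have [m Em] : exists m, reg s' 41 = m by exists (reg s' 41).
rewrite Em in H1 H2 H3 H4 lt *.
have R' y : y \notin [:: 40; 42; 46] ++ wregs c -> reg s' y = reg s y.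
  by rewrite mem_cat negb_or => /andP[y1 y2]; rewrite F ?R2.
have A' a : a \notin [:: aBit; aReach] -> arr s' a =1 arr s a.
  rewrite !inE negb_or => /andP[/negbTE h1 /negbTE h2] z.
  by rewrite G ?A2 //= !inE ?h1 ?h2.
have L := @p_layerP s0 s' n k u m un.
rewrite sem_seq.
have {L}L : reach_upto n k s0 u m.+1 (sem p_layer s').
  apply: L => //.
  - by move=> z lz; rewrite !A' //; apply: arcs.
  - by move=> z lz; rewrite !A' //; apply: pows.
  - by rewrite R'.
  - by rewrite R'.
  - by rewrite R'.
  - by rewrite A' // R'.
  - by move=> z; rewrite A'.
  - by move=> z; rewrite A'.
have R3 y : y \notin wregs p_layer -> reg (sem p_layer s') y = reg s' y.
  exact: sem_reg.
have A3 a : a \notin warrs p_layer -> arr (sem p_layer s') a =1 arr s' a.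
  by move=> h z; apply: sem_arr.
move: (sem p_layer s') L R3 A3 => s3 L R3 A3.
rewrite sem_seq; set d := PIf _ _ _.
have D40 : reg (sem d s3) 40 != 0 <->
   exists2 m', m' < m.+1 & reachable n (adjacent s0) (edge_color n s0) k u m' v.
  rewrite /d sem_if /= (R3 42) // (R3 38) // (R' 38) // (A3 aV) // A' // sv H1.
  have Lm := L m v (leqnn _) vn.
  case: ifP => h; rewrite semE /=.
    by split=> // _; exists m => //; apply/Lm.
  rewrite (R3 40) // H4; split=> -[m' lm h']; first by exists m' => //; apply: leqW.
  move: lm h'; rewrite ltnS leq_eqVlt => /orP[/eqP->|lm] h'; last by exists m'.
  by move/Lm: h'; rewrite h.
have R4 y : y \notin [:: 40] -> reg (sem d s3) y = reg s3 y.
  by move=> h; apply: sem_reg.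
have A4 : arr (sem d s3) =2 arr s3 by move=> a z; apply: sem_arr.
move: (sem d s3) D40 R4 A4 => s4 {d} D40 R4 A4.
rewrite sem_seq; set e := p_incr _ _ _.
have E4 : reg s4 rK = k by rewrite R4 // R3 // R'.
have inc := @p_incrP aBit aTwo rK s4 (fun=> 2) m isT isT.
have {}inc : forall i, i < k -> arr (sem e s4) aBit i = digit (fun=> 2) m.+1 i.
  rewrite -E4; apply: inc => i; rewrite E4 => ik; rewrite A4 A3 //.
    by rewrite A' //; have [_ ->] := pows _ ik.
  by rewrite H2 // digit2.
have R5 y : y \notin wregs e -> reg (sem e s4) y = reg s4 y by apply: sem_reg.
have A5 a : a \notin [:: aBit] -> arr (sem e s4) a =1 arr s4 a.
  by rewrite inE => /negbTE h z; apply: sem_arr; rewrite /e /= !inE h.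
move: (sem e s4) inc R5 A5 => s5 inc R5 A5.
rewrite sem_assign /=; split=> /=.
- rewrite (R5 42) // (R5 rN) // R4 // R4 // R3 // R3 // H1 R' // sN.
  by rewrite mulSn addnC.
- by move=> i ik; rewrite inc // digit2.
- by move=> m' w lm lw /=; rewrite A5 // A4; apply: L.
- by rewrite (R5 40).
Qed.

(** [rAns] is set on success and never reset, so that over the rounds it accumulates a
    disjunction. *)
Definition p_check : prog :=
  39 ::= Const 1 ;;
  PFor 38 rN2
    (PIf (Get aV #38 -e Get aU #38)
       (PIf (Get aIn (Const 1 +e #rN2 +e #38))
          (p_reach ;; PIf #40 PSkip (39 ::= Const 0)) PSkip) PSkip) ;;
  PIf #39 (rAns ::= Const 1) PSkip.

Lemma p_checkP s n k :
  0 < n -> arcs_ok n s -> powers_ok n k s ->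
  reg s rN = n -> reg s rN2 = n * n -> reg s rK = k -> reg s rPow = 2 ^ k ->
  reg (sem p_check s) rAns != 0 <->
  reg s rAns != 0 \/
  forall x, x < n * n -> requested n s x -> exists p,
    rainbow_walk n (adjacent s) (edge_color n s) k (x %/ n) (x %% n) p.
Proof.
move=> n0 arcs pows sN sN2 sK sP.
rewrite /p_check sem_seq sem_assign sem_seq; set s0 := set_reg _ _ _.
set c := PFor 38 _ _.
pose I m s' := reg s' 39 != 0 <->
  forall x, x < m -> requested n s x -> exists p,
    rainbow_walk n (adjacent s) (edge_color n s) k (x %/ n) (x %% n) p.
have : I (reg s0 rN2) (sem c s0).
  apply: sem_for => // s' lt F G H.
  have {}lt : reg s' 38 < n * n by rewrite -sN2.
  have [x Ex] : exists x, reg s' 38 = x by exists (reg s' 38).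
  rewrite Ex in lt H *; have [U V _] := arcs _ lt.
  rewrite /I /= sem_if /= Ex !G // U V subn_neq0.
  have rE : requested n s x = (x %/ n < x %% n) && (arr s aIn (1 + n * n + x) != 0) by [].
  set s3 := if _ then _ else _.
  have key : reg s3 39 != 0 <-> reg s' 39 != 0 /\ (requested n s x -> exists p,
      rainbow_walk n (adjacent s) (edge_color n s) k (x %/ n) (x %% n) p).
    rewrite /s3 rE; case: ifP => _ /=; last by rewrite sem_skip; split=> [|[]].
    rewrite sem_if /= Ex !G // (F rN2) //= sN2.
    case: ifP => _; last by rewrite sem_skip; split=> [|[]].
    have := @p_reachP s s' n k (x %/ n) (x %% n).
    rewrite Ex !G // U V ltn_divLR // ltn_pmod // => R.
    have {}R : reg (sem p_reach s') 40 != 0 <-> exists p,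
        rainbow_walk n (adjacent s) (edge_color n s) k (x %/ n) (x %% n) p.
      apply: R => //; rewrite ?F //.
      - by move=> z lz; rewrite !G //; apply: arcs.
      - by move=> z lz; rewrite !G //; apply: pows.
      - by move=> z; rewrite G.
      - by move=> z; rewrite G.
    rewrite sem_seq sem_if /=; case: ifP R => h R; rewrite semE /=.
      by rewrite sem_reg //; split=> [->|[]] //; split=> // _; apply/R.
    by split=> // -[_ /(_ isT)/R].
  split=> [/key[/H h hx] y|h].
    by rewrite ltnS leq_eqVlt => /orP[/eqP->|/h].
  apply/key; split; first by apply/H => y ly; apply: h; apply: leqW.
  exact: h.
have -> : reg s0 rN2 = n * n by [].
have R17 : reg (sem c s0) rAns = reg s rAns by rewrite sem_reg.
rewrite /I => H; rewrite sem_if /=; case: ifP H => h H; rewrite semE /=.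
  by split=> // _; right; apply/H.
by rewrite R17; split=> [|[|/H]] //; left.
Qed.

(** * Soundness and completeness of the search *)

Lemma rainbow_walk_ext n (adj adj' : pred nat) cf cf' k u v p :
  adj =1 adj' -> cf =1 cf' ->
  rainbow_walk n adj cf k u v p -> rainbow_walk n adj' cf' k u v p.
Proof.
move=> Ea Ec [P L U A].
have E : walk_colors n cf' u p = walk_colors n cf u p.
  by rewrite /walk_colors; elim: p u {P L U A} => //= y p IH u; rewrite IH Ec.
split; rewrite ?E //.
by rewrite -(eq_path (e := fun x y => (y < n) && adj (x * n + y))) // => x y; rewrite Ea.
Qed.

(* [inp] is the content of the input array, [h] assigns colors to edge indices. *)
Definition satisfies n k (inp h : nat -> nat) : Prop :=
  forall x, x < n * n -> x %/ n < x %% n -> inp (1 + n * n + x) != 0 ->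
  exists p, rainbow_walk n (fun y => inp (1 + y) != 0) (fun y => h (sym n y)) k
              (x %/ n) (x %% n) p.

Lemma satisfies_ext n k inp inp' h h' :
  inp =1 inp' -> h =1 h' -> satisfies n k inp h -> satisfies n k inp' h'.
Proof.
move=> Ei Eh S x lx uv; rewrite -Ei => rx; have [p W] := S x lx uv rx.
by exists p; apply: rainbow_walk_ext W => y /=; rewrite ?Ei ?Eh.
Qed.

Definition p_body : prog :=
  p_tab ;; p_hash ;; p_exc ;; p_check ;; p_incr aDig aRad rL.

Definition p_main : prog := PFor 30 rNum p_body.

(** The precomputed data on which each round relies and which, by [ready_frame], no round alters. *)
Definition ready n k q (inp : nat -> nat) s : Prop :=
  [/\ [/\ reg s rN = n, reg s rN2 = n * n, reg s rK = k & reg s rPow = 2 ^ k],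
      [/\ reg s rQ2 = 2 * q, reg s rB = (q %/ 8).+1,
          reg s rR = q.+1 * (q %/ 8).+1, reg s rOffB = offB q & reg s rOffC = offC q],
      [/\ reg s rX = nexc, arcs_ok n s & powers_ok n k s],
      radices_are (radices (n * n) k q (q %/ 8).+1) s
    & arr s aIn =1 inp].

Lemma ready_frame n k q inp s s' :
  (forall y, y \notin 30 :: wregs p_body -> reg s' y = reg s y) ->
  (forall a j, a \notin warrs p_body -> arr s' a j = arr s a j) ->
  ready n k q inp s -> ready n k q inp s'.
Proof.
move=> F G [[h1 h2 h3 h4] [r2 r3 r4 r5 r6] [r1 h5 h6] [h7 h8 h9] h10].
split; try (by split; rewrite F).
- by split=> [|x lx|x lx]; rewrite ?F ?G //; [exact: h5|exact: h6].
- by split=> [i||]; rewrite ?F ?G.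
- by move=> i; rewrite G.
Qed.

(** The coloring [h] tested in a round is left existential, since away from [F] it may depend on
    stale table cells. Soundness uses nothing else about it, completeness only its values on [F]. *)
Lemma p_bodyP n k q inp s (F : {set 'I_(n * n)}) col t
    (r := nth 0 (radices (n * n) k q (q %/ 8).+1)) (s' := sem p_body s) :
  0 < n -> 0 < k -> ready n k q inp s ->
  (forall i, i < reg s rL -> arr s aDig i = digit r t i) ->
  (forall i, i < reg s rL -> arr s' aDig i = digit r t.+1 i) /\
  exists h, (reg s' rAns != 0 <-> reg s rAns != 0 \/ satisfies n k inp h) /\
    (good_digits q (q %/ 8).+1 F col (arr s aDig) -> forall x : 'I_(n * n),
       x \in F -> h x = col x).
Proof.
move=> n0 k0 rd dig.
have w0 : 0 < n * n by rewrite muln_gt0 n0.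
have rpos i : i < reg s rL -> arr s aRad i = r i /\ 0 < r i.
  case: rd => _ _ _ [H1 H2 _] _; rewrite H2 H1 => li; split=> //.
  have /allP H : all (fun z => 0 < z) (radices (n * n) k q (q %/ 8).+1).
    by rewrite /radices /= !all_cat !all_nseq !muln_gt0 /= n0 k0 !orbT.
  by apply: H; apply: mem_nth.
have szL : 2 <= reg s rL by case: rd => _ _ _ [_ -> _] _.
rewrite /s' /p_body sem_seq.
set b := (q %/ 8).+1 in r rd rpos dig *.
have [[sN sN2 sK sP] [sQ2 sB sR sOB sOC] [sX arcs pows] _ sin] := rd.
have T1 := p_tabP sB sQ2 sOB sOC.
have R1 y : y \notin wregs p_tab -> reg (sem p_tab s) y = reg s y by apply: sem_reg.
have A1 a : a \notin warrs p_tab -> arr (sem p_tab s) a =1 arr s a.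
  by move=> h z; apply: sem_arr.
move: (sem p_tab s) T1 R1 A1 => s1 T1 R1 A1; rewrite sem_seq.
have d0 : arr s1 aDig 0 < q.+1 * b.
  by rewrite A1 // dig ?(leq_trans _ szL) // ltn_pmod //; have [_] := rpos 0 (ltnW szL).
have d1 : arr s1 aDig 1 < n * n.
  by rewrite A1 // dig // ltn_pmod.
have T2 := @p_hashP s1 _ _ _ (etrans (R1 rN2 isT) sN2) (etrans (R1 rR isT) sR) d0 d1 (erefl _).
have R2 y : y \notin wregs p_hash -> reg (sem p_hash s1) y = reg s1 y by apply: sem_reg.
have A2 a : a \notin warrs p_hash -> arr (sem p_hash s1) a =1 arr s1 a.
  by move=> h z; apply: sem_arr.
move: (sem p_hash s1) T2 R2 A2 => s2 T2 R2 A2; rewrite sem_seq.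
have T3 := @p_excP s2 col.
have R3 y : y \notin wregs p_exc -> reg (sem p_exc s2) y = reg s2 y by apply: sem_reg.
have A3 a : a \notin warrs p_exc -> arr (sem p_exc s2) a =1 arr s2 a.
  by move=> h z; apply: sem_arr.
move: (sem p_exc s2) T3 R3 A3 => s3 T3 R3 A3; rewrite sem_seq.
have R3' y : y \notin wregs p_tab ++ wregs p_hash ++ wregs p_exc -> reg s3 y = reg s y.
  rewrite mem_cat (mem_cat _ (wregs p_hash)) => h.
  by rewrite R3 ?R2 ?R1 //; apply: contra h => ->; rewrite ?orbT.
have A3' a : a \notin [:: aTab; aCol] -> arr s3 a =1 arr s a.
  rewrite !inE negb_or => /andP[/negbTE a1 /negbTE a2] z.
  by rewrite A3 ?A2 ?A1 //= ?inE ?a1 ?a2.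
have T4 := @p_checkP s3 n k n0.
have {}T4 : reg (sem p_check s3) rAns != 0 <->
    reg s rAns != 0 \/ satisfies n k inp (arr s3 aCol).
  have -> : reg s rAns = reg s3 rAns by rewrite R3'.
  have E : arr s3 aIn =1 inp by move=> z; rewrite A3'.
  have {}T4 : reg (sem p_check s3) rAns != 0 <->
      reg s3 rAns != 0 \/ satisfies n k (arr s3 aIn) (arr s3 aCol).
    have arcs3 : arcs_ok n s3 by move=> x lx; rewrite !A3' //; apply: arcs.
    have pows3 : powers_ok n k s3 by move=> x lx; rewrite !A3' //; apply: pows.
    have [X Y] := T4 arcs3 pows3 (etrans (R3' rN isT) sN) (etrans (R3' rN2 isT) sN2)
                     (etrans (R3' rK isT) sK) (etrans (R3' rPow isT) sP).
    split=> [/X[h|S]|[h|S]]; [by left| |by apply: Y; left|].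
      by right=> x lx uv rx; apply: S => //; rewrite /requested uv.
    by apply: Y; right=> x lx /andP[uv rx]; apply: S.
  split=> [/T4[h|S]|[h|S]]; [by left| |by apply/T4; left|].
    by right; apply: satisfies_ext S.
  by apply/T4; right; apply: satisfies_ext S => // z; rewrite E.
have R4 y : y \notin wregs p_check -> reg (sem p_check s3) y = reg s3 y by apply: sem_reg.
have A4 a : a \notin warrs p_check -> arr (sem p_check s3) a =1 arr s3 a.
  by move=> h z; apply: sem_arr.
move: (sem p_check s3) T4 R4 A4 => s4 T4 R4 A4.
have L4 : reg s4 rL = reg s rL by rewrite R4 // R3'.
split.
  rewrite -L4; apply: p_incrP => // i; rewrite L4 => li.
    by rewrite A4 // A3' //; apply: rpos.
  by rewrite A4 // A3' //; apply: dig.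
exists (arr s3 aCol); split; first by rewrite sem_reg.
case=> g1 g2 x xF.
have X2 : reg s2 rX = nexc by rewrite R2 // R1.
have D2 : arr s2 aDig =1 arr s aDig by move=> z; rewrite A2 // A1.
apply: T3; rewrite X2; first by move=> i li; rewrite !D2; apply: g1.
case: (g2 x xF) => [[i li xi]|H]; first by left; exists i; rewrite ?D2.
right; rewrite T2 // T1 -(H (arr s aTab)) !A1 //.
Qed.

Lemma p_mainP n k q inp s (F : {set 'I_(n * n)}) (col : nat -> nat) :
  0 < n -> 0 < k -> ready n k q inp s ->
  (forall i, arr s aDig i = 0) -> reg s rAns = 0 ->
  (reg (sem p_main s) rAns != 0 -> exists h, satisfies n k inp h) /\
  (#|F| <= q -> (forall x, col x < k) ->
   (forall h : nat -> nat, (forall x : 'I_(n * n), x \in F -> h x = col x) ->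
      satisfies n k inp h) ->
   reg (sem p_main s) rAns != 0).
Proof.
move=> n0 k0 rd dig0 ans0.
set b := (q %/ 8).+1; set rs := radices (n * n) k q b; set r := nth 0 rs.
(* Round [t] is good whatever the digit array contains beyond its first [reg s rL] cells. *)
pose goodt t := forall v, (forall i, i < reg s rL -> v i = digit r t i) ->
   good_digits q b F col v.
pose hyp := forall h : nat -> nat, (forall x : 'I_(n * n), x \in F -> h x = col x) ->
   satisfies n k inp h.
pose I m s' := [/\ ready n k q inp s',
  forall i, i < reg s rL -> arr s' aDig i = digit r m i,
  reg s' rAns != 0 -> exists h, satisfies n k inp h &
  hyp -> forall t, t < m -> goodt t -> reg s' rAns != 0].
have [_ _ _ [rad sL sNum] _] := rd.
have : I (reg s rNum) (sem p_main s).
  apply: sem_for => //.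
    split=> //; last by rewrite /= ans0.
    by move=> i _; rewrite dig0 /digit div0n mod0n.
  move=> s' lt Fr Gr [H1 H2 H3 H4].
  have [m Em] : exists m, reg s' 30 = m by exists (reg s' 30).
  rewrite Em in lt H2 H4 *.
  have sL' : reg s' rL = reg s rL by rewrite Fr.
  have [|B1 [h [B2 B3]]] := @p_bodyP n k q inp s' F col m n0 k0 H1.
    by rewrite sL'.
  split.
  - apply: (ready_frame _ _ H1) => [y|a j ja]; last by rewrite -(sem_arr s' j ja).
    by rewrite inE negb_or => /andP[/negbTE H y2] /=; rewrite H sem_reg.
  - by rewrite -sL'.
  - by move=> /B2[/H3|S] //; exists h.
  - move=> hy t; rewrite ltnS leq_eqVlt => /orP[/eqP->|lt'] gt; apply/B2.
      by right; apply: hy; apply: B3; apply: gt.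
    by left; apply: (H4 hy t).
case=> _ _ H1 H2; split=> // Fq colk hy.
have w0 : 0 < n * n by rewrite muln_gt0 n0.
have q8 : q < 8 * b by rewrite /b mulnC -ltn_divLR.
have [v lv gv] := good_digits_exist w0 k0 Fq q8 colk.
have [t lt tv] := digit_surj (r := r) lv.
apply: (H2 hy t).
  by rewrite sNum (big_nth 0) big_mkord.
move=> v' v'E; apply: gv => i li; rewrite -tv // v'E //.
by rewrite sL.
Qed.

(** * Assembly of the program and its running time *)

Definition p_consts k : prog :=
  rN ::= Get aIn (Const 0) ;; rK ::= Const k ;; rPow ::= Const (2 ^ k) ;;
  rX ::= Const nexc ;; rOne ::= Const 1 ;; rTwo ::= Const 2.
Definition p_tables : prog := p_arcs ;; p_powers ;; p_count.
Definition p_sizes : prog := p_width ;; p_table_size.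

(* With at least [n ^ 2] colors, all edges may get distinct colors. *)
Definition solver k : cmd :=
  Seq (compile (p_consts k)) (Seq (compile p_square)
    (If (Const k.+1 -e #rN2) (compile (0 ::= Const 1))
      (Seq (compile p_tables) (Seq (compile p_mulk) (Seq (compile p_sizes)
        (Seq (compile p_radices) (Seq (compile p_main)
          (compile (0 ::= #rAns))))))))).

Definition nrequests n (inp : nat -> nat) : nat :=
  \sum_(x < n * n) ((x %/ n < x %% n) && (inp (1 + n * n + x) != 0)).

Lemma exec_prog_pow c s Z : stable c -> {in bounds c, forall x, reg s x < Z} ->
  exists2 t, exec (compile c) s t (sem c s) & t <= psize c * Z ^ size (bounds c).
Proof.
move=> st bZ; have [t e l] := exec_prog s st; exists t => //.
apply: leq_trans l (leq_trans (tbound_le _ _) _); rewrite leq_mul2l; apply/orP; right.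
elim: (bounds c) bZ => [|x l IH] bZ; first by rewrite big_nil.
rewrite big_cons expnS leq_mul ?bZ ?mem_head // IH // => y yl.
by rewrite bZ // inE yl orbT.
Qed.

(** Of the eleven loop bounds of [p_main], only [rNum] and [rPow] may be superpolynomial, and each
    occurs once; the other nine are below [Z]. *)
Lemma exec_main s Z : {in [:: rQ2; rN2; rX; rK; rN; rL], forall x, reg s x < Z} ->
  exists2 t, exec (compile p_main) s t (sem p_main s)
   & t <= psize p_main * ((reg s rNum).+1 * (reg s rPow).+1 * Z ^ 9).
Proof.
move=> bZ; have [//|t e l] := @exec_prog p_main s; exists t => //.
apply: leq_trans l (leq_trans (tbound_le _ _) _); rewrite leq_mul2l; apply/orP; right.
rewrite [bounds _]/= !big_cons big_nil muln1.
have H x : x \in [:: rQ2; rN2; rX; rK; rN; rL] -> reg s x < Z by apply: bZ.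
have H1 := H rQ2 isT; have H2 := H rN2 isT; have H3 := H rX isT.
have H4 := H rK isT; have H5 := H rN isT; have H6 := H rL isT.
have -> : Z ^ 9 = Z * (Z * (Z * (Z * (Z * (Z * (Z * (Z * Z))))))).
  by rewrite !expnS expn0 muln1.
by rewrite -!mulnA leq_mul2l !(mulnCA (reg s rPow).+1) !leq_mul ?orbT.
Qed.

Lemma ready_final k s n inp (q := k * nrequests n inp)
    (s1 := sem (p_consts k) s) (s2 := sem p_square s1) (s3 := sem p_tables s2)
    (s4 := sem p_mulk s3) (s5 := sem p_sizes s4) (s6 := sem p_radices s5) :
  0 < n -> inp 0 = n -> arr s aIn =1 inp ->
  (forall a i, a != aIn -> arr s a i = 0) -> (forall x, x != 0 -> reg s x = 0) ->
  [/\ [/\ reg s2 rN = n, reg s2 rN2 = n * n & reg s2 rK = k],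
      [/\ reg s3 rS = nrequests n inp, reg s4 rQ = q & reg s5 rQ = q],
      [/\ reg s5 rB = (q %/ 8).+1, reg s5 rR = q.+1 * (q %/ 8).+1, reg s5 rQ2 = 2 * q,
          reg s5 rOne = 1 & reg s5 rTwo = 2],
      [/\ reg s5 rN2 = n * n, reg s5 rK = k & reg s5 rX = nexc] &
      [/\ ready n k q inp s6, forall i, arr s6 aDig i = 0 & reg s6 rAns = 0]].
Proof.
move=> n0 inp0 sin sa sr.
have A1 a i : arr s1 a i = arr s a i by apply: sem_arr.
have R1 : [/\ reg s1 rN = n, reg s1 rK = k, reg s1 rPow = 2 ^ k, reg s1 rX = nexc &
    [/\ reg s1 rOne = 1, reg s1 rTwo = 2 & reg s1 rAns = 0]].
  by rewrite /s1 /p_consts !semE /= sin inp0 sr.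
case: R1 => N1 K1 P1' X1 [O1 T1 Ans1]; clearbody s1.
have N2 : reg s2 rN2 = n * n by rewrite /s2 p_squareP N1.
have R2 y : y \notin wregs p_square -> reg s2 y = reg s1 y by apply: sem_reg.
have A2 a i : arr s2 a i = arr s a i by rewrite -A1; apply: sem_arr.
clearbody s2.
have R3 y : y \notin wregs p_tables -> reg s3 y = reg s2 y by apply: sem_reg.
have A3 a i : a \notin warrs p_tables -> arr s3 a i = arr s2 a i by apply: sem_arr.
have [arcs3 pows3 S3] : [/\ arcs_ok n s3, powers_ok n k s3 & reg s3 rS = nrequests n inp].
  rewrite /s3 /p_tables 2!sem_seq.
  have arcs := p_arcsP n0 (etrans (R2 rN isT) N1) N2.
  have Ra y : y \notin wregs p_arcs -> reg (sem p_arcs s2) y = reg s2 y by apply: sem_reg.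
  have Aa a i : a \notin warrs p_arcs -> arr (sem p_arcs s2) a i = arr s2 a i by apply: sem_arr.
  move: (sem p_arcs s2) arcs Ra Aa => sa' arcs Ra Aa.
  have pows := @p_powersP sa'; rewrite !Ra // !R2 // N1 K1 in pows.
  have Rb y : y \notin wregs p_powers -> reg (sem p_powers sa') y = reg sa' y by apply: sem_reg.
  have Ab a i : a \notin warrs p_powers -> arr (sem p_powers sa') a i = arr sa' a i.
    exact: sem_arr.
  move: (sem p_powers sa') pows Rb Ab => sb pows Rb Ab.
  have arcsb : arcs_ok n sb by move=> x lx; rewrite !Ab //; apply: arcs.
  have cnt := @p_countP sb n (etrans (Rb rN2 isT) (etrans (Ra rN2 isT) N2)) arcsb.
  split.
  - by move=> x lx; rewrite !(@sem_arr p_count) //; apply: arcsb.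
  - by move=> x lx; rewrite !(@sem_arr p_count) //; apply: pows.
  - by rewrite cnt; apply: eq_bigr => x _; rewrite /requested Ab // Aa // A2 sin.
have Q4 : reg s4 rQ = q by rewrite /s4 p_mulkP S3 R3 // R2 // K1.
have R4 y : y \notin wregs p_mulk -> reg s4 y = reg s3 y by apply: sem_reg.
have A4 a i : arr s4 a i = arr s3 a i by apply: sem_arr.
clearbody s4.
have R5 y : y \notin wregs p_sizes -> reg s5 y = reg s4 y by apply: sem_reg.
have A5 a i : arr s5 a i = arr s4 a i by apply: sem_arr.
have [B5 R5' Q25 OB5 OC5] : [/\ reg s5 rB = (q %/ 8).+1, reg s5 rR = q.+1 * (q %/ 8).+1,
    reg s5 rQ2 = 2 * q, reg s5 rOffB = offB q & reg s5 rOffC = offC q].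
  have B := p_widthP s4; rewrite Q4 in B.
  have Q : reg (sem p_width s4) rQ = q by rewrite sem_reg.
  rewrite /s5 /p_sizes sem_seq.
  have [H1 H2 H3 H4] := p_table_sizeP (sem p_width s4).
  rewrite Q in H1 H2 H3 H4; rewrite H1 H2 H3 H4 -B.
  by split=> //; apply: (@sem_reg p_table_size).
have Q5 : reg s5 rQ = q by rewrite R5.
have F5 y : y \notin wregs p_square ++ wregs p_tables ++ wregs p_mulk ++ wregs p_sizes ->
    reg s5 y = reg s1 y.
  rewrite mem_cat (mem_cat _ (wregs p_tables)) (mem_cat _ (wregs p_mulk)) => h.
  by rewrite R5 ?R4 ?R3 ?R2 //; apply: contra h => ->; rewrite ?orbT.
have N25 : reg s5 rN2 = n * n by rewrite R5 // R4 // R3.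
have rad := @p_radicesP s5 (n * n) k q (q %/ 8).+1.
have R6 y : y \notin wregs p_radices -> reg s6 y = reg s5 y by apply: sem_reg.
have A6 a i : a \notin warrs p_radices -> arr s6 a i = arr s5 a i by apply: sem_arr.
split=> //.
- by split=> //; rewrite R2.
- by split=> //; rewrite F5.
- by split=> //; rewrite F5.
split; last by rewrite R6 // F5.
  split=> //.
  - by rewrite !R6 // N25 !F5.
  - by rewrite !R6.
  - split; first by rewrite R6 // F5.
      by move=> x lx; rewrite !A6 // !A5 !A4; apply: arcs3.
    by move=> x lx; rewrite !A6 // !A5 !A4; apply: pows3.
  - apply: rad => //; try by rewrite F5.
    by move=> i; rewrite A5 A4 A3 // A2 sa.
  - by move=> i; rewrite A6 // A5 A4 A3 // A2 sin.
by move=> i; rewrite A6 // A5 A4 A3 // A2 sa.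
Qed.

(** The size of [p_consts k] is the same for all [k], so this constant is uniform in [k]. The
    summand 10 covers the comparison of [k] with [n ^ 2] and the final assignment. *)
Definition solver_cost : nat :=
  psize (p_consts 0) + psize p_square + psize p_tables + psize p_mulk
  + psize p_sizes + psize p_radices + psize p_main + 10.

(** Exceeds every polynomial loop bound when [k < n * n]. The power comes from the table size
    [q.+1 * (q %/ 8).+1] with [q <= (n * n) ^ 2], the coefficient from the number of digits. *)
Definition solver_scale n : nat := (2 * nexc + 50) * (n * n) ^ 4.

Lemma nrequests_le n inp : nrequests n inp <= n * n.
Proof.
rewrite -[leqRHS]card_ord -sum1_card /nrequests.
by apply: leq_sum => x _; case: (_ && _).
Qed.

(** The exponent 14 comes from [p_radices], whose seven fills contain two loops each; the search
    itself accounts for an exponent 9 only. *)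
Lemma solver_run k n inp s (q := k * nrequests n inp) :
  0 < n -> 0 < k -> inp 0 = n -> arr s aIn =1 inp ->
  (forall a i, a != aIn -> arr s a i = 0) -> (forall x, x != 0 -> reg s x = 0) ->
  exists t s', exec (solver k) s t s' /\
    if n * n <= k then output s' != 0 /\ t <= solver_cost * solver_scale n
    else
      [/\ output s' != 0 -> exists h, satisfies n k inp h,
          forall (F : {set 'I_(n * n)}) (col : nat -> nat), #|F| <= q ->
            (forall x, col x < k) ->
            (forall h : nat -> nat, (forall x : 'I_(n * n), x \in F -> h x = col x) ->
              satisfies n k inp h) -> output s' != 0
        & t <= solver_cost *
            ((\prod_(r <- radices (n * n) k q (q %/ 8).+1) r).+1 * (2 ^ k).+1
             * solver_scale n ^ 14)].
Proof.
move=> n0 k0 inp0 sin sa sr.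
have := ready_final k n0 inp0 sin sa sr.
rewrite -/q; set s1 := sem (p_consts k) s; set s2 := sem p_square s1.
set s3 := sem p_tables s2; set s4 := sem p_mulk s3; set s5 := sem p_sizes s4.
set s6 := sem p_radices s5.
case=> [[N2 NN2 K2] [S3 Q4 Q5] [B5 R5 Q25 O5 T5] [N5 K5 X5] [rd dig ans]].
have u0 : 0 < n * n by rewrite muln_gt0 n0.
set Z := solver_scale n.
have Zle c j m : c <= 2 * nexc + 50 -> j <= 4 -> m <= c * (n * n) ^ j -> m <= Z.
  move=> cle jle /leq_trans; apply; rewrite leq_mul // leq_pexp2l //.
have n_u : n <= n * n by rewrite leq_pmulr.
have Z1 : 0 < Z by apply: (Zle 1 0); lia.
have NZ : n < Z.
  by apply: (Zle 2 1) => //; rewrite expn1; lia.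
have N2Z : n * n < Z.
  by apply: (Zle 2 1) => //; rewrite expn1; lia.
have [//|t1 e1 l1] := @exec_prog_pow (p_consts k) s Z isT.
have N1 : reg s1 rN = n by rewrite -N2 /s2 sem_reg.
have [|t2 e2 l2] := @exec_prog_pow p_square s1 Z isT.
  by move=> x; rewrite [bounds _]/= inE => /eqP->; rewrite N1.
have l1' : t1 <= psize (p_consts 0) by rewrite muln1 in l1.
case: leqP => [nk|kn].
  exists (t1 + (t2 + (4 + 2))), (set_reg s2 0 1); split; last first.
    split=> //; move: l1' l2; rewrite /solver_cost [Z ^ _]expn1.
    move: (psize (p_consts 0)) (psize p_square) (psize p_tables) (psize p_mulk)
      (psize p_sizes) (psize p_radices) (psize p_main) => c0 c1 c2 c3 c4 c5 c6 l1' l2.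
    apply: (@leq_trans ((c0 + c1 + 10) * Z)); last by rewrite leq_mul2r; lia.
    have : c0 <= c0 * Z by rewrite leq_pmulr.
    by rewrite !mulnDl; move: l1' l2 Z1; clear; lia.
  apply: (ExecSeq e1); apply: (ExecSeq e2).
  apply: (@ExecIfTrue (Const k.+1 -e #rN2)) (ExecAssign s2 0 (Const 1)).
  by rewrite /= NN2 subn_neq0 ltnS.
have sn := nrequests_le n inp.
have qu : q <= (n * n) ^ 2 by rewrite expnS expn1 leq_mul // ltnW.
have [|t3 e3 l3] := @exec_prog_pow p_tables s2 Z isT.
  move=> x; rewrite [bounds _]/= !inE => /or3P[] /eqP->; rewrite ?NN2 ?K2 //.
  by apply: ltn_trans N2Z.
have [|t4 e4 l4] := @exec_prog_pow p_mulk s3 Z isT.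
  by move=> x; rewrite [bounds _]/= !inE => /eqP->; rewrite S3 (leq_ltn_trans sn).
have U2 : 0 < (n * n) ^ 2 by rewrite expn_gt0 u0.
have QZ : q < Z by apply: (Zle 2 2) => //; move: qu U2; clear; lia.
have Q2Z : 2 * q < Z by apply: (Zle 4 2) => //; move: qu U2; clear; lia.
have LZ : offC q + q < Z.
  apply: (Zle (2 * nexc + 50) 2) => //.
  have : 1 * nexc <= (n * n) ^ 2 * nexc by rewrite leq_mul2r U2 orbT.
  by rewrite /offC /offB /offW; move: qu U2; clear; lia.
have b_q : q %/ 8 <= q := leq_div q 8.
have RZ : q.+1 * (q %/ 8).+1 < Z.
  apply: (Zle 5 4) => //; rewrite -[4]/(2 + 2) expnD.
  have H1 : q.+1 <= 2 * (n * n) ^ 2 by move: qu U2; clear; lia.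
  have := leq_mul H1 (leq_trans (b_q : (q %/ 8).+1 <= q.+1) H1).
  have : 0 < (n * n) ^ 2 * (n * n) ^ 2 by rewrite muln_gt0 U2.
  by clear; lia.
have [|t5 e5 l5] := @exec_prog_pow p_sizes s4 Z isT.
  by move=> x; rewrite [bounds _]/= !inE orbb => /eqP->; rewrite Q4.
have XZ : nexc < Z.
  apply: (Zle (nexc + 1) 0); [lia|by []|by rewrite expn0; lia].
have OZ : 2 < Z by apply: (Zle 3 0) => //; lia.
have [|t6 e6 l6] := @exec_prog_pow p_radices s5 Z isT.
  move=> x; rewrite [bounds _]/= => xin.
  have {xin} : x \in [:: rOne; rR; rN2; rX; rK; rQ2; rTwo; rQ; rB].
    by move: x xin; apply/allP.
  rewrite !inE => /or4P[/eqP->|/eqP->|/eqP->|].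
  - by rewrite O5 ltnW.
  - by rewrite R5.
  - by rewrite N5.
  move=> /or4P[/eqP->|/eqP->|/eqP->|/or3P[] /eqP->].
  - by rewrite X5.
  - by rewrite K5 (ltn_trans kn).
  - by rewrite Q25.
  - by rewrite T5.
  - by rewrite Q5.
  - by rewrite B5 (leq_ltn_trans _ RZ) // leq_pmull.
have [[n6 nn6 k6 p6] [q26 b6 r6 _ _] [x6 _ _] [_ L6 num6] _] := rd.
have [|t7 e7 l7] := @exec_main s6 Z.
  move=> x; rewrite !inE => /or4P[/eqP->|/eqP->|/eqP->|/or3P[] /eqP->].
  - by rewrite q26.
  - by rewrite nn6.
  - by rewrite x6.
  - by rewrite k6 (ltn_trans kn).
  - by rewrite n6.
  - by rewrite L6 size_radices.
have M := p_mainP _ _ n0 k0 rd dig ans.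
set s7 := sem p_main s6 in e7 M.
exists (t1 + (t2 + (4 + (t3 + (t4 + (t5 + (t6 + (t7 + 2)))))))).
exists (set_reg s7 0 (reg s7 rAns)); split.
  do 2!(apply: ExecSeq; [eassumption|]).
  apply: (@ExecIfFalse (Const k.+1 -e #rN2)); first by rewrite /= NN2 subn_eq0.
  do 5!(apply: ExecSeq; [eassumption|]).
  exact: (ExecAssign s7 0 #rAns).
have -> : output (set_reg s7 0 (reg s7 rAns)) = reg s7 rAns by [].
split.
- by move=> h; have [H _] := M set0 (fun=> 0); apply: H.
- by move=> F col; have [_ H] := M F col.
rewrite num6 p6 in l7; set N := \prod_(_ <- _) _ in l7 *.
set W := N.+1 * _ * _.
have ZW j : j <= 14 -> Z ^ j <= W.
  move=> jle; rewrite /W -[Z ^ j]mul1n leq_mul ?muln_gt0 //.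
  by rewrite leq_pexp2l.
have l c m t : m <= 14 -> t <= c * Z ^ m -> t <= c * W.
  by move=> ? /leq_trans; apply; rewrite leq_mul2l ZW ?orbT.
have W1 : 1 <= W by apply: ZW 0 isT.
have := l _ _ _ (isT : 0 <= 14) l1.
move: l2 l3 => /l-/(_ isT) l2 /l-/(_ isT) l3.
move: l4 l5 l6 => /l-/(_ isT) l4 /l-/(_ isT) l5 /l-/(_ isT) l6.
have {}l7 : t7 <= psize p_main * W.
  apply: leq_trans l7 _; rewrite leq_mul2l /W; apply/orP; right.
  by rewrite leq_mul2l leq_pexp2l ?orbT.
have -> : psize (p_consts k) = psize (p_consts 0) by [].
move: l2 l3 l4 l5 l6 l7; rewrite /solver_cost.
move: (psize (p_consts 0)) (psize p_square) (psize p_tables) (psize p_mulk)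
  (psize p_sizes) (psize p_radices) (psize p_main) => c0 c1 c2 c3 c4 c5 c6.
by rewrite !mulnDl; move: W1; clear; lia.
Qed.

(** * Paths *)

(** Whenever the start recurs, the closed part before its recurrence is dropped. The labels that
    remain form a subsequence, so distinctness of colors is inherited. *)
Lemma shorten_subseq (T : eqType) (C : eqType) (e : rel T) (f : T -> T -> C) u p :
  path e u p -> exists p', [/\ path e u p', last u p' = last u p, uniq (u :: p')
    & subseq (pairmap f u p') (pairmap f u p)].
Proof.
elim: p u => [|x p IH] u; first by exists [::].
case/andP => eux /IH[p' [P L U S]].
have [uin|uout] := boolP (u \in x :: p'); last first.
  by exists (x :: p'); split=> //=; rewrite ?eux ?eqxx // uout.
case/splitPl: uin P L U S => a b Lu; rewrite cat_path last_cat pairmap_cat Lu.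
case/andP => _ P L; rewrite -cat_cons lastI Lu cat_rcons cat_uniq => /and3P[_ _ U] S.
exists b; split=> //=; apply: subseq_trans (subseq_cons _ _).
by apply: subseq_trans S; apply: suffix_subseq.
Qed.

Lemma last_rev_belast (T : Type) (x : T) p :
  last (last x p) (rev (belast x p)) = x.
Proof. by case: p => //= y p; rewrite rev_cons last_rcons. Qed.

Lemma pairmap_rev (T C : Type) (f : T -> T -> C) x p :
  (forall a b, f a b = f b a) ->
  pairmap f (last x p) (rev (belast x p)) = rev (pairmap f x p).
Proof.
move=> fC; elim: p x => //= y p IH x.
by rewrite !rev_cons -cats1 pairmap_cat /= IH last_rev_belast fC cats1.
Qed.

Lemma rainbow_path_rev n (e : rel 'I_n) col u v p : symmetric e ->
  rainbow_path e col u v p -> exists p', rainbow_path e col v u p'.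
Proof.
move=> sym_e [P L U C]; exists (rev (belast u p)); rewrite -L; split.
- by rewrite rev_path (eq_path (e' := e)).
- exact: last_rev_belast.
- by rewrite -rev_rcons -lastI rev_uniq.
- by rewrite pairmap_rev ?rev_uniq // => a b; rewrite setUC.
Qed.

Lemma uniq_path_edges (T : finType) (u : T) p :
  uniq (u :: p) -> uniq (pairmap (fun x y => [set x; y]) u p).
Proof.
elim: p u => //= x p IH u /andP[up Up]; rewrite IH // andbT.
have sub S : S \in pairmap (fun a b => [set a; b]) x p -> forall z, z \in S -> z \in x :: p.
  elim: p x {IH Up up} => //= y p IH x; rewrite inE => /orP[/eqP->|/IH H] z.
    by rewrite !inE => /orP[] ->; rewrite ?orbT.
  by move/H; rewrite [in X in _ -> X]inE => ->; rewrite orbT.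
by apply: contra up => /sub/(_ u); apply; rewrite !inE eqxx.
Qed.

Lemma nth_allpairs_row (S T : Type) (f : S -> T -> nat) s t t' x0 y0 i j :
  i < size s -> j < size t ->
  nth 0 ([seq f x y | x <- s, y <- t] ++ t') (i * size t + j) =
  f (nth x0 s i) (nth y0 t j).
Proof.
elim: s i => //= x s IH [|i] li lj; rewrite -catA nth_cat size_map.
  by rewrite lj (nth_map y0).
rewrite mulSn -addnA ltnNge leq_addr /= addKn; exact: IH.
Qed.

(** * Graphs and their encodings *)

(** Translates a coloring of indices into one of vertex sets; the default 0 concerns only sets that
    are not pairs. *)
Definition edge_index n (E : {set 'I_n}) : nat :=
  if [pick x : 'I_n * 'I_n | (x.1 < x.2) && (E == [set x.1; x.2])] is Some x
  then x.1 * n + x.2 else 0.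

Lemma ordered_pair_inj n (a b c d : 'I_n) :
  a < b -> c < d -> [set a; b] = [set c; d] -> a = c /\ b = d.
Proof.
move=> ab cd E.
have : b \in [set c; d] by rewrite -E !inE eqxx orbT.
have : a \in [set c; d] by rewrite -E !inE eqxx.
rewrite !inE => /orP[]/eqP Ea /orP[]/eqP Eb; split=> //; exfalso;
  by move: ab cd; rewrite Ea Eb ?ltnn // => /ltn_trans H /H; rewrite ltnn.
Qed.

Lemma edge_index_lt n (a b : 'I_n) : a < b -> edge_index [set a; b] = a * n + b.
Proof.
move=> ab; rewrite /edge_index; case: pickP => [[c d]|/(_ (a, b))] /=.
  by case/andP => cd /eqP /(ordered_pair_inj ab cd)[-> ->].
by rewrite ab eqxx.
Qed.

Lemma divn_index n (a b : 'I_n) : (a * n + b) %/ n = a.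
Proof.
have n0 : 0 < n by apply: leq_ltn_trans (ltn_ord a).
by rewrite divnMDl // divn_small ?addn0.
Qed.

Lemma modn_index n (a b : 'I_n) : (a * n + b) %% n = b.
Proof. by rewrite modnMDl modn_small. Qed.

Lemma edge_index_sym n (a b : 'I_n) :
  a != b -> edge_index [set a; b] = sym n (a * n + b).
Proof.
move=> ab; rewrite /sym divn_index modn_index; case: ltnP => [|le].
  exact: edge_index_lt.
by rewrite setUC edge_index_lt // ltn_neqAle le eq_sym ab.
Qed.

Lemma index_lt n (a b : 'I_n) : a * n + b < n * n.
Proof.
apply: (@leq_trans (a.+1 * n)); first by rewrite mulSn addnC ltn_add2r.
by rewrite leq_mul2r ltn_ord orbT.
Qed.

Lemma sym_lt n (a b : 'I_n) : sym n (a * n + b) < n * n.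
Proof. by rewrite /sym divn_index modn_index; case: ifP => _; apply: index_lt. Qed.

Lemma edge_index_inj n (a b c d : 'I_n) : a != b -> c != d ->
  edge_index [set a; b] = edge_index [set c; d] -> [set a; b] = [set c; d].
Proof.
have H (x y z t : 'I_n) : x * n + y = z * n + t -> x = z /\ y = t.
  move=> E; split; apply: val_inj => /=.
    by rewrite -(divn_index x y) E divn_index.
  by rewrite -(modn_index x y) E modn_index.
move=> ab cd; rewrite !edge_index_sym // /sym !divn_index !modn_index.
by case: ifP => _; case: ifP => _ /H[-> ->] //; rewrite setUC.
Qed.

Section Graph.

Variable G : request_graph.
Let n := nvertices G.
Let inp := nth 0 (encode_request_graph G).

Lemma input_adj (u v : 'I_n) : inp (1 + (u * n + v)) = adj u v.
Proof.
rewrite /inp /encode_request_graph add1n /=.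
have := @nth_allpairs_row _ _ (fun u v : 'I_n => nat_of_bool (adj u v))
  (enum 'I_n) (enum 'I_n) _ u v u v.
by rewrite !size_enum_ord !nth_ord_enum => ->.
Qed.

Lemma input_request (u v : 'I_n) :
  inp (1 + n * n + (u * n + v)) = ([set u; v] \in requests G).
Proof.
rewrite /inp /encode_request_graph -addnA add1n /=.
rewrite nth_cat size_allpairs !size_enum_ord ltnNge leq_addr /= addKn.
have := @nth_allpairs_row _ _ (fun u v : 'I_n => nat_of_bool ([set u; v] \in requests G))
   (enum 'I_n) (enum 'I_n) [::] u v u v.
by rewrite !size_enum_ord !nth_ord_enum cats0 => ->.
Qed.

Lemma encode_size : size (encode_request_graph G) = (n * n + n * n).+1.
Proof. by rewrite /= size_cat !size_allpairs !size_enum_ord. Qed.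

Lemma nvertices_pos : 0 < n.
Proof. exact: nvertices_gt0. Qed.

Lemma request_neq (u v : 'I_n) : [set u; v] \in requests G -> u != v.
Proof. by move/requests_card2; rewrite cards2; case: (u != v). Qed.

Lemma adj_neq (u v : 'I_n) : adj u v -> u != v.
Proof. by apply: contraTneq => ->; rewrite adj_irrefl. Qed.

Lemma nat_walk (u : 'I_n) p :
  path (fun x y => (y < n) && (inp (1 + (x * n + y)) != 0)) u p ->
  exists2 p' : seq 'I_n, p = map val p' & path (@adj G) u p'.
Proof.
elim: p u => [|x p IH] u; first by exists [::].
case/andP => /andP[xn ux] /(IH (Ordinal xn))[p' -> P].
exists (Ordinal xn :: p') => //=; rewrite P andbT.
by have := input_adj u (Ordinal xn); rewrite /= => E; rewrite E in ux; case: adj ux.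
Qed.

Lemma walk_colors_val cf (u : 'I_n) p :
  walk_colors n cf u (map val p) = pairmap (fun a b : 'I_n => cf (a * n + b)) u p.
Proof. by rewrite /walk_colors; elim: p u => //= x p IH u; rewrite IH. Qed.

Lemma satisfies_colorable k h :
  0 < k -> satisfies n k inp h -> subset_rainbow_colorable k G.
Proof.
(* Colors outside the palette are replaced by 0, which exists as [0 < k]; the walks found use only
   colors below [k], so they keep theirs. *)
move=> k0 S; pose col E := if h (@edge_index n E) < k then h (@edge_index n E) else 0.
have colk E : col E < k by rewrite /col; case: ifP.
exists col; split=> [u v _|u v uvR]; first exact: colk.
have lt_case (a b : 'I_n) : a < b -> [set a; b] \in requests G ->
    exists p, rainbow_path (@adj G) col a b p.
  move=> ab abR; have [||p [P L U A]] := S _ (index_lt a b).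
  - by rewrite divn_index modn_index.
  - by rewrite input_request abR.
  rewrite divn_index modn_index in P L U A.
  have [p' Ep P'] := nat_walk P; rewrite Ep last_map in L.
  rewrite Ep walk_colors_val in U A.
  set f := fun a b : 'I_n => _ in U A.
  have [q [Pq Lq Uq Sq]] := shorten_subseq f P'.
  have Af : all (fun c => c < k) (pairmap f a q).
    by apply/allP => c /(mem_subseq Sq); apply: (allP A).
  exists q; split=> //; first by apply: val_inj; rewrite /= Lq.
  have -> : pairmap (fun x y => col [set x; y]) a q = pairmap f a q.
    elim: q a Pq Af {P' L U A Lq Uq Sq ab abR P Ep} => //= y q IH a /andP[ay Pq] /andP[fk Af].
    by rewrite IH // /col (edge_index_sym (adj_neq ay)) fk.
  exact: subseq_uniq Sq U.
(* Only pairs with [u < v] are tested; for the others the path is reversed. *)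
have := request_neq uvR; case: (ltngtP u v) => [lt _|lt _|/val_inj->]; last by rewrite eqxx.
  exact: lt_case.
have [|p Rp] := lt_case v u lt; first by rewrite setUC.
by have [p'] := rainbow_path_rev (@adj_sym G) Rp; exists p'.
Qed.

(** Edge indices are pairwise distinct and below [n * n]; used as colors they make every path
    without repeated vertices rainbow, and connectedness provides such paths. *)
Lemma all_distinct_colorable k : n * n <= k -> subset_rainbow_colorable k G.
Proof.
move=> nk; exists (@edge_index n); split=> [u v uv|u v uvR].
  by rewrite edge_index_sym ?adj_neq // (leq_trans (sym_lt u v)).
have /connectP[p0 P0 ->] := adj_connected u v.
have [p [P L U _]] := shorten_subseq (fun _ _ : 'I_n => 0) P0.
exists p; split=> //.
have -> : pairmap (fun x y => edge_index [set x; y]) u p =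
   map (@edge_index n) (pairmap (fun x y => [set x; y]) u p).
  by elim: p u {P0 uvR P L U} => //= x p IH u; rewrite IH.
rewrite map_inj_in_uniq ?uniq_path_edges // => E E'.
have two D : D \in pairmap (fun x y => [set x; y]) u p ->
    exists a b : 'I_n, a != b /\ D = [set a; b].
  elim: p u P {P0 uvR L U} => //= x p IH u /andP[ux P].
  by rewrite inE => /orP[/eqP->|/(IH _ P)] //; exists u, x; rewrite adj_neq.
by move=> /two[a [b [ab ->]]] /two[c [d [cd ->]]]; apply: edge_index_inj.
Qed.

(** Without colors there are no edges, and a connected graph without edges has a single vertex,
    hence no requests. *)
Lemma colorable0 : subset_rainbow_colorable 0 G <-> n = 1.
Proof.
split=> [[col [ec _]]|n1].
  have n0 := nvertices_pos.
  case: (ltngtP 1 n) => // [n2|]; last by lia.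
  have := adj_connected (Ordinal n0 : 'I_(nvertices G)) (Ordinal n2).
  by case/connectP => -[|x p] //= /andP[/ec].
have one (u v : 'I_n) : u = v.
  by apply: val_inj => /=; have := ltn_ord u; have := ltn_ord v; lia.
exists (fun=> 0); split=> u v.
  by rewrite (one u v) => /adj_neq; rewrite eqxx.
by rewrite (one u v) => /request_neq; rewrite eqxx.
Qed.

Let vx (i : nat) : 'I_n := insubd (Ordinal nvertices_pos) i.

Lemma vx_val (u : 'I_n) : vx u = u.
Proof. by rewrite /vx valKd. Qed.

Lemma vxK i : i < n -> vx i = i :> nat.
Proof. by move=> li; rewrite /vx val_insubd li. Qed.

Lemma div_mod_vx (x : 'I_(n * n)) : x = vx (x %/ n) * n + vx (x %% n) :> nat.
Proof. by rewrite !vxK ?ltn_pmod ?ltn_divLR ?nvertices_pos // -divn_eq. Qed.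

Lemma request_vx (x : 'I_(n * n)) :
  (x %/ n < x %% n) && (inp (1 + n * n + x) != 0) =
  (vx (x %/ n) < vx (x %% n)) && ([set vx (x %/ n); vx (x %% n)] \in requests G).
Proof.
rewrite [in inp _](div_mod_vx x) input_request !vxK ?ltn_pmod ?ltn_divLR ?nvertices_pos //.
by case: (_ \in _).
Qed.

Lemma nrequests_card : nrequests n inp <= #|requests G|.
Proof.
rewrite /nrequests.
under eq_bigr do rewrite request_vx.
pose A := [set x : 'I_(n * n) | (vx (x %/ n) < vx (x %% n)) &&
   ([set vx (x %/ n); vx (x %% n)] \in requests G)].
have -> : \sum_(x < n * n) ((vx (x %/ n) < vx (x %% n)) &&
   ([set vx (x %/ n); vx (x %% n)] \in requests G)) = #|A|.
  by rewrite -sum1_card [RHS]big_mkcond; apply: eq_bigr => x _; rewrite inE; case: (_ && _).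
rewrite -(@card_in_imset _ _ (fun x : 'I_(n * n) => [set vx (x %/ n); vx (x %% n)])).
  apply/subset_leq_card/subsetP => E /imsetP[x]; rewrite inE => /andP[_ xR] ->.
  exact: xR.
move=> x y; rewrite !inE => /andP[lx _] /andP[ly _] /(ordered_pair_inj lx ly)[E1 E2].
by apply: val_inj => /=; rewrite (div_mod_vx x) (div_mod_vx y) E1 E2.
Qed.

Lemma colorable_satisfies k : 0 < k -> subset_rainbow_colorable k G ->
  exists (F : {set 'I_(n * n)}) (c : nat -> nat),
  [/\ #|F| <= k * nrequests n inp, forall x, c x < k &
     forall h : nat -> nat, (forall x : 'I_(n * n), x \in F -> h x = c x) ->
       satisfies n k inp h].
Proof.
move=> k0 [col [colk paths]].
pose c x := let a := vx (x %/ n) in let b := vx (x %% n) in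
  if adj a b then col [set a; b] else 0.
have ck x : c x < k by rewrite /c; case: ifP => // /colk.
have cE (a b : 'I_n) : adj a b -> c (sym n (a * n + b)) = col [set a; b].
  move=> ab; rewrite /c /sym divn_index modn_index.
  case: (a < b) => /=; rewrite divn_index modn_index !vx_val ?ab //.
  by rewrite adj_sym ab setUC.
pose good (x : 'I_(n * n)) := (x %/ n < x %% n) && (inp (1 + n * n + x) != 0).
pose edges u p := pairmap (fun a b : 'I_n => sym n (a * n + b)) u p.
have ex_path (x : 'I_(n * n)) : exists p : seq 'I_n, good x ->
    rainbow_path (@adj G) col (vx (x %/ n)) (vx (x %% n)) p.
  case: (boolP (good x)) => gx; last by exists [::].
  have := gx; rewrite /good request_vx => /andP[_ xR].
  by have [p Hp] := paths _ _ xR; exists p.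
have [P PP] := fin_all_exists ex_path.
have colors_lt u p : path (@adj G) u p ->
    all (fun i => i < k) (pairmap (fun a b => col [set a; b]) u p).
  by elim: p u => //= x p IH u /andP[ux Pp]; rewrite colk ?IH.
(* The edges of a rainbow path inject into the palette. *)
have size_P x : good x -> size (P x) <= k.
  move=> /PP[Px _ _ Ux]; rewrite -(size_iota 0 k).
  rewrite -(size_pairmap (fun a b => col [set a; b]) (vx (x %/ n))).
  apply: uniq_leq_size => // i /(allP (colors_lt _ _ Px)).
  by rewrite mem_iota.
pose fl := flatten [seq (if good x then edges (vx (x %/ n)) (P x) else [::])
                      | x <- enum 'I_(n * n)].
exists [set x : 'I_(n * n) | val x \in fl], c; split=> //.
- have -> : nrequests n inp = \sum_(x < n * n) good x by [].
  apply: (@leq_trans (size fl)).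
    rewrite cardE -(size_map val); apply: uniq_leq_size.
      by rewrite map_inj_uniq ?enum_uniq //; apply: val_inj.
    by move=> z /mapP[x]; rewrite mem_enum inE => xf ->.
  rewrite size_flatten /shape -map_comp sumnE big_map big_enum /= big_distrr /=.
  apply: leq_sum => x _; case: ifP => gx //=.
  by rewrite size_pairmap muln1 size_P.
move=> h hF x lx lt rx.
have gx : good (Ordinal lx) by rewrite /good /= lt.
have [Px Lx Ux Cx] := PP _ gx; rewrite /= in Px Lx Ux Cx.
have sub : {subset edges (vx (x %/ n)) (P (Ordinal lx)) <= fl}.
  move=> z zin; apply/flattenP; exists (edges (vx (x %/ n)) (P (Ordinal lx))) => //.
  by apply/mapP; exists (Ordinal lx); rewrite ?mem_enum // gx.
have E u p : path (@adj G) u p -> {subset edges u p <= fl} ->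
    pairmap (fun a b : 'I_n => h (sym n (a * n + b))) u p =
    pairmap (fun a b => col [set a; b]) u p.
  elim: p u => //= y p IH u /andP[uy Pp] sb.
  rewrite IH //; last by move=> z zin; apply: sb; rewrite inE zin orbT.
  rewrite -cE // -(hF (Ordinal (sym_lt u y))) // inE.
  by apply: sb; rewrite inE eqxx.
have xd : x %/ n < n by rewrite ltn_divLR ?nvertices_pos.
have xm : x %% n < n by rewrite ltn_pmod ?nvertices_pos.
exists (map val (P (Ordinal lx))); rewrite -(vxK xd) -[in X in rainbow_walk _ _ _ _ _ X](vxK xm).
split.
- elim: (P _) (vx _) Px {Lx Ux Cx sub} => //= y p IH u /andP[uy Pp].
  by rewrite ltn_ord IH // andbT -[_ + y]/(u * n + y) (input_adj u y) uy.
- by rewrite last_map Lx.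
- by rewrite walk_colors_val E.
- by rewrite walk_colors_val E // colors_lt.
Qed.

End Graph.

(** * Running times *)

Lemma prod_nseq m x : \prod_(r <- nseq m x) r = x ^ m.
Proof. by rewrite big_nseq iter_muln muln1. Qed.

Definition width_const : nat := 4 ^ 8.

Lemma width_const_gt0 : 0 < width_const.
Proof. by rewrite expn_gt0. Qed.

(** The reason for the divisor 8: [4 * (q %/ 8).+1 <= q %/ 2 + 4 <= q] once [q >= 8]. The finitely
    many smaller [q] go into the constant. *)
Lemma width_pow_le q : (4 * (q %/ 8).+1) ^ q <= width_const * q ^ q.
Proof.
rewrite /width_const.
have [lt|ge] := ltnP q 8.
  rewrite divn_small // muln1 -[leqLHS]muln1 leq_mul ?leq_pexp2l ?expn_gt0 //.
    exact: ltnW.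
  by case: q lt.
rewrite -[leqLHS]mul1n leq_mul ?expn_gt0 // leq_exp2r; last exact: leq_trans ge.
by lia.
Qed.

Opaque width_const.

(** Passes from the number of requests that the program counts to the parameter, which is shown to
    be at least as large. *)
Lemma pow_mono k s S : 0 < k -> s <= S ->
  (k ^ 2 * s) ^ (k * s) <= (k ^ 2 * S) ^ (k * S).
Proof.
move=> k0 le; case: (posnP S) le => [->|S0 le].
  by rewrite leqn0 => /eqP->.
case: (posnP s) => [->|s0]; first by rewrite !muln0 expn0 expn_gt0 muln_gt0 expn_gt0 k0 S0.
apply: (@leq_trans ((k ^ 2 * S) ^ (k * s))).
  by rewrite leq_exp2r ?muln_gt0 ?k0 // leq_mul2l le orbT.
by rewrite leq_pexp2l ?muln_gt0 ?expn_gt0 ?k0 // leq_mul2l le orbT.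
Qed.

(** In powers of [n * n]: [nexc] for the exceptional edges, [nexc] for their colors (as
    [k <= n * n]), and 5 for the multiplier of the hash. *)
Definition search_exp : nat := nexc + nexc + 5.

Lemma prod_radices_le n k s (q := k * s) : 0 < n -> 0 < k -> k <= n * n ->
  s <= n * n ->
  \prod_(r <- radices (n * n) k q (q %/ 8).+1) r <=
    4 * width_const * ((n * n) ^ search_exp * (k ^ 2 * s) ^ (k * s)).
Proof.
move=> n0 k0 kn sn; set w := n * n in kn sn *; set b := (q %/ 8).+1.
have w0 : 0 < w by rewrite muln_gt0 n0.
have E : \prod_(r <- radices w k q b) r =
   (q.+1 * b * w) * (w ^ nexc * k ^ nexc) * ((4 * b) ^ q * k ^ q).
  rewrite /radices !big_cons !big_cat !prod_nseq /= expnMn [2 ^ _]expnM.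
  by rewrite -!mulnA.
have Hb : q.+1 * b * w <= 4 * w ^ 5.
  have qw : q <= w ^ 2 by rewrite expnS expn1 leq_mul.
  have q1 : q.+1 <= 2 * w ^ 2.
    by have : 0 < w ^ 2; [rewrite expn_gt0 w0|move: qw; clear; lia].
  have b1 : b <= 2 * w ^ 2 by apply: leq_trans q1; rewrite ltnS leq_div.
  rewrite (expnSr w 4) mulnA leq_mul2r; apply/orP; right.
  by apply: leq_trans (leq_mul q1 b1) _; rewrite mulnACA -expnD.
have Hx : w ^ nexc * k ^ nexc <= w ^ (nexc + nexc).
  by rewrite expnD leq_mul2l; apply/orP; right; case: (nexc) => // m; rewrite leq_exp2r.
have Hq : (4 * b) ^ q * k ^ q <= width_const * (k ^ 2 * s) ^ (k * s).
  have -> : (k ^ 2 * s) ^ (k * s) = q ^ q * k ^ q by rewrite -expnMn /q mulnAC expnS expn1.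
  by rewrite mulnA leq_mul2r width_pow_le orbT.
rewrite E; apply: leq_trans (leq_mul (leq_mul Hb Hx) Hq) _.
rewrite /search_exp (expnD _ (nexc + nexc) 5).
move: (w ^ 5) (w ^ _) (width_const) (_ ^ (k * s)) => x y z t.
by apply/eq_leq; clear; lia.
Qed.

(** The 16 combines the 4 of [prod_radices_le] with two doublings that absorb the successors of the
    number of rounds and of [2 ^ k]. In [time_exp], 56 is [4 * 14], from the power of
    [solver_scale]. *)
Definition time_const : nat := solver_cost * (16 * width_const * (2 * nexc + 50) ^ 14).
Definition time_exp : nat := 2 * (search_exp + 56).

Lemma time_le n k s S (q := k * s) :
  0 < n -> 0 < k -> k <= n * n -> s <= n * n -> s <= S ->
  solver_cost * ((\prod_(r <- radices (n * n) k q (q %/ 8).+1) r).+1 * (2 ^ k).+1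
             * solver_scale n ^ 14) <=
  time_const * ((k ^ 2 * S) ^ (k * S) * 2 ^ k * n ^ time_exp).
Proof.
move=> n0 k0 kn sn sS; rewrite /time_const -(mulnA solver_cost) leq_mul2l; apply/orP; right.
have le1 := prod_radices_le n0 k0 kn sn; rewrite -/q in le1.
set P := \prod_(_ <- _) _ in le1 *.
set M := (k ^ 2 * S) ^ (k * S).
have le2 : (k ^ 2 * s) ^ (k * s) <= M by apply: pow_mono.
have M0 : 0 < M.
  rewrite /M expn_gt0; case: (posnP S) => [->|S0]; first by rewrite !muln0.
  by rewrite muln_gt0 expn_gt0 k0 S0.
set w := n * n in le1 *; have w0 : 0 < w by rewrite muln_gt0 n0.
have -> : n ^ time_exp = w ^ search_exp * w ^ 56.
  by rewrite -expnD /time_exp expnM /w expnS expn1.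
rewrite /solver_scale -/w expnMn -expnM; move: ((2 * nexc + 50) ^ 14) => C.
have -> : (4 * 14 = 56)%N by [].
have le3 : P.+1 <= 2 * (4 * width_const * (w ^ search_exp * M)).
  have : P <= 4 * width_const * (w ^ search_exp * M).
    by apply: leq_trans le1 _; rewrite leq_mul2l leq_mul2l le2 !orbT.
  have : 0 < 4 * width_const * (w ^ search_exp * M).
    have w1 : 0 < w ^ search_exp by rewrite expn_gt0 w0.
    by rewrite muln_gt0 [0 < 4 * _]muln_gt0 width_const_gt0 muln_gt0 w1 M0.
  by move: (4 * _ * _) => x; clear; lia.
have le4 : (2 ^ k).+1 <= 2 * 2 ^ k.
  by have : 0 < 2 ^ k; [rewrite expn_gt0|move: (2 ^ k) => x; clear; lia].
apply: leq_trans (leq_mul (leq_mul le3 le4) (leqnn (C * w ^ 56))) _.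
move: (width_const) (w ^ 56) (w ^ search_exp) (2 ^ k) => x y z t.
apply/eq_leq; clear; lia.
Qed.

(** The case [k = 0], where the product of the radices would vanish. As [n >= 1], the truncated
    difference [2 - n] is nonzero exactly when [n = 1]. *)
Definition p_no_color : prog :=
  1 ::= Get aIn (Const 0) ;; 0 ::= Const 2 -e #1.

Lemma solvable_subset_rainbow k :
  @solvable_in_time (subset_rainbow_coloring k)
    (fun G : request_graph =>
       time_const * ((k ^ 2 * #|requests G|) ^ (k * #|requests G|)
            * 2 ^ k * nvertices G ^ time_exp)).
Proof.
have pos_const : 10 <= time_const.
  have H : 10 <= solver_cost by apply: leq_addl.
  by apply: leq_trans H _; rewrite leq_pmulr.
case: (posnP k) => [->|k0].
  exists (compile p_no_color) => G; set s := init _.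
  have [//|t e l] := @exec_prog p_no_color s.
  have n0 := nvertices_pos G.
  exists t, (sem p_no_color s); split=> //.
    have -> : output (sem p_no_color s) = 2 - nvertices G by [].
    by rewrite /= colorable0; split=> [|->] //; lia.
  rewrite mul0n expn0 !mul1n; apply: leq_trans l _.
  have -> : tbound p_no_color s = 7 by [].
  apply: leq_trans (leq_trans (_ : 7 <= 10) pos_const) _ => //.
  by rewrite leq_pmulr // expn_gt0 n0.
exists (solver k) => G; set n := nvertices G; set inp := nth 0 (encode_request_graph G).
set s := init _; have n0 : 0 < n := nvertices_pos G.
have [||||||t [s' [e]]] := @solver_run k n inp s => //.
- by case.
- by move=> x /negbTE H; rewrite /s /= H.
have cardS := nrequests_card G.
case: leqP => [nk [out tm]|kn [sound complete tm]].
  exists t, s'; split=> //.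
    split=> [_|_]; first exact: all_distinct_colorable.
    by apply/eqP.
  apply: leq_trans tm _; rewrite /time_const -mulnA leq_mul2l; apply/orP; right.
  rewrite /solver_scale; have D0 : 0 < 16 * width_const by rewrite muln_gt0 width_const_gt0.
  move: (16 * width_const) D0 => D D0.
  set C := 2 * nexc + 50; have C0 : 0 < C by rewrite /C addn_gt0 orbT.
  have -> : C ^ 14 = C * C ^ 13 by rewrite -expnS.
  have X1 : (n * n) ^ 4 <= n ^ time_exp.
    have -> : (n * n) ^ 4 = n ^ 8 by rewrite -[n * n](expnM n 1 2) ?expn1 -expnM.
    by rewrite leq_pexp2l // /time_exp; move: search_exp => m; clear; lia.
  have X2 : 0 < D * C ^ 13 by rewrite muln_gt0 D0 expn_gt0 C0.
  have X3 : 0 < (k ^ 2 * #|requests G|) ^ (k * #|requests G|) * 2 ^ k.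
    rewrite muln_gt0 !expn_gt0 andbT; case: (posnP #|requests G|) => [->|S0].
      by rewrite !muln0.
    by rewrite muln_gt0 expn_gt0 k0 S0.
  rewrite [_ * (C * _)]mulnCA -(mulnA C) leq_mul2l; apply/orP; right.
  apply: leq_trans X1 _; rewrite [leqRHS]mulnA leq_pmull //.
  by rewrite muln_gt0 X2 X3.
exists t, s'; split=> //.
- rewrite /= ; split=> [/eqP out|col].
    by have [h /(satisfies_colorable k0)] := sound out.
  have [F [c [Fq ck H]]] := colorable_satisfies k0 col.
  by apply/eqP; apply: (complete F c).
- apply: leq_trans tm _; apply: time_le => //; first exact: ltnW.
  exact: nrequests_le.
Qed.

(** * Computability of the parameter dependence *)

Definition p_exp_init (A k : nat) : prog :=
  1 ::= Get aIn (Const 0) ;; 2 ::= Const 0 ;; 3 ::= Const k ;;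
  4 ::= Const (A * 2 ^ k).

Definition p_exp_base (k : nat) : prog :=
  PFor 20 1 (2 ::= #2 +e Const (k ^ 2)).

Definition p_exp_loop : prog :=
  PFor 21 1
    (PFor 22 3 (5 ::= Const 0 ;; PFor 23 2 (5 ::= #5 +e #4) ;; 4 ::= #5)).

Lemma computable_exp A k :
  computable (fun m => A * 2 ^ k * (k ^ 2 * m) ^ (k * m)).
Proof.
pose q1 := p_exp_init A k; pose q2 := p_exp_base k.
pose q3 := p_exp_loop; pose q4 := 0 ::= #4.
exists (Seq (compile q1) (Seq (compile q2) (Seq (compile q3) (compile q4)))) => m.
set s0 := init _.
have [//|t1 e1 _] := @exec_prog q1 s0; have [//|t2 e2 _] := @exec_prog q2 (sem q1 s0).
have [//|t3 e3 _] := @exec_prog q3 (sem q2 (sem q1 s0)).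
have [//|t4 e4 _] := @exec_prog q4 (sem q3 (sem q2 (sem q1 s0))).
exists (t1 + (t2 + (t3 + t4))), (sem q4 (sem q3 (sem q2 (sem q1 s0)))).
split; first by do 3?(apply: ExecSeq; [eassumption|]).
have R1 : [/\ reg (sem q1 s0) 1 = m, reg (sem q1 s0) 2 = 0, reg (sem q1 s0) 3 = k
  & reg (sem q1 s0) 4 = A * 2 ^ k] by [].
move: (sem q1 s0) R1 => {e1 e2 e3 e4} s1 [E1 E2 E3 E4].
have B : reg (sem q2 s1) 2 = k ^ 2 * m.
  pose I j s' := reg s' 2 = k ^ 2 * j.
  have : I (reg s1 1) (sem q2 s1); last by rewrite E1.
  apply: sem_for => //; first by rewrite /I /= E2 muln0.
  by move=> s' lt F G; rewrite /I semE /= => ->; rewrite mulnS addnC.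
have R2 y : y \notin [:: 2; 20] -> reg (sem q2 s1) y = reg s1 y.
  by move=> h; apply: sem_reg; rewrite /q2 /= !inE in h *; rewrite orbC.
move: (sem q2 s1) B R2 => s2 B R2.
have [N1 N3 N4] : [/\ reg s2 1 = m, reg s2 3 = k & reg s2 4 = A * 2 ^ k] by rewrite !R2.
rewrite -[output _]/(reg (sem q3 s2) 4).
pose base := k ^ 2 * m.
pose I j s' := reg s' 4 = A * 2 ^ k * base ^ (k * j).
have : I (reg s2 1) (sem q3 s2); last by rewrite N1.
apply: sem_for => //; first by rewrite /I /= N4 muln0 muln1.
move=> s' lt F G H; rewrite /I /=; set c := PFor 22 _ _.
pose J j s3 := reg s3 4 = reg s' 4 * base ^ j.
have : J (reg s' 3) (sem c s').
  apply: sem_for => //; first by rewrite /J muln1.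
  move=> s3 lt3 F3 G3 H3; rewrite /J 2!sem_seq !sem_assign.
  set s4 := set_reg s3 5 _; set d := PFor 23 _ _.
  pose L j s5 := reg s5 5 = reg s3 4 * j.
  have : L (reg s4 2) (sem d s4).
    apply: sem_for => //; first by rewrite /L muln0.
    move=> s5 lt5 F5 G5; rewrite /L semE /= => ->.
    by rewrite (F5 4) // mulnS addnC.
  have -> : reg s4 2 = base by rewrite /= F3 // F.
  by rewrite /L /= => ->; rewrite H3 -mulnA -expnSr.
have -> : reg s' 3 = k by rewrite F.
by rewrite /J => ->; rewrite H -mulnA -expnD mulnS addnC.
Qed.

(** For [S >= 2] the factor [(k ^ 2) ^ (k * S)], which is not bounded for fixed [k], is absorbed
    through [k <= 2 ^ k <= S ^ k]. The constant in front serves [S <= 1], where powers of [S] cannot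
    help. *)
Lemma fixed_colors_le k S :
  (k ^ 2 * S) ^ (k * S) <= ((k ^ 2) ^ k).+1 * S ^ ((2 * k * k + k) * S).
Proof.
case: S => [|[|S]].
- by rewrite !muln0 expn0 muln1.
- by rewrite !muln1 exp1n muln1 ltnW.
set T := S.+2.
rewrite expnMn mulnDl expnD mulnA leq_mul2r; apply/orP; right.
apply: leq_trans (_ : T ^ (2 * k * k * T) <= _); last by rewrite leq_pmull.
have -> : 2 * k * k * T = (2 * k) * (k * T) by rewrite !mulnA.
rewrite [T ^ _]expnM; case: (posnP (k * T)) => [->|kT] //.
rewrite leq_exp2r // [2 * k]mulnC [T ^ _]expnM.
rewrite leq_exp2r //; apply: leq_trans (ltnW (ltn_expl k (_ : 1 < 2))) _ => //.
by case: (k) => // m; rewrite leq_exp2r.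
Qed.

Lemma leq_pexp m n e : m <= n -> m ^ e <= n ^ e.
Proof. by case: e => // e le; rewrite leq_exp2r. Qed.

Lemma solvable_in_time_le (P : param_problem) (T T' : instance P -> nat) :
  (forall I, T I <= T' I) -> solvable_in_time T -> solvable_in_time T'.
Proof.
move=> le [p H]; exists p => I; have [t [s [e y l]]] := H I.
by exists t, s; split=> //; apply: leq_trans l _.
Qed.

Theorem theorem6 :
  [/\ forall k : nat,
        fixed_parameter_tractable (subset_rainbow_coloring k),
      exists A c : nat, forall k : nat,
        @solvable_in_time (subset_rainbow_coloring k)
          (fun G : request_graph =>
             A * ((k ^ 2 * #|requests G|) ^ (k * #|requests G|)
                  * 2 ^ k * nvertices G ^ c))
    & forall k : nat, exists A b c : nat,
        @solvable_in_time (subset_rainbow_coloring k)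
          (fun G : request_graph =>
             A * (#|requests G| ^ (b * #|requests G|) * nvertices G ^ c))].
Proof.
split=> [k||k].
- exists (fun m => time_const * 2 ^ k * (k ^ 2 * m) ^ (k * m)), time_exp.
  split; first exact: computable_exp.
  apply: solvable_in_time_le (solvable_subset_rainbow k) => G.
  have H a b c d d' : d <= d' -> a * (b * c * d) <= a * c * b * d'.
    by move=> le; rewrite (mulnC b) !mulnA leq_mul2l le orbT.
  apply: H; apply: leq_pexp; apply: (@leq_trans (size (encode_request_graph G))) => //.
  by rewrite encode_size ltnW // ltnS (leq_trans _ (leq_addr _ _)) // leq_pmulr ?nvertices_pos.
- exists time_const, time_exp => k; exact: solvable_subset_rainbow.
- exists (time_const * (((k ^ 2) ^ k).+1 * 2 ^ k)), (2 * k * k + k), time_exp.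
  apply: solvable_in_time_le (solvable_subset_rainbow k) => G.
  have H a x b y c z : x <= c * z -> a * (x * b * y) <= a * (c * b) * (z * y).
    move=> le; rewrite -(mulnA a) leq_mul2l -(mulnA x) -(mulnA c) (mulnCA b).
    by rewrite (mulnA c) (leq_mul le) ?orbT.
  by apply: H; apply: fixed_colors_le.
Qed.
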